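(* Let $H$ and $K$ be separable Hilbert spaces and let $G_1,G_2$ be discrete countable abelian groups. Let $\pi:G_1\to B(H)$ and $\sigma:G_2\to B(K)$ be frame representations with frame vectors $v\in H$ and $w\in K$, respectively. Let $\lambda$ and $\mu$ be the normalized Haar measures on the dual groups $\hat G_1$ and $\hat G_2$. Suppose that $U:H\to L^2(E,\lambda|E)$ and $V:K\to L^2(F,\mu|F)$ are decomposition operators of $\pi$ and $\sigma$, respectively, where $E\subseteq\hat G_1$ and $F\subseteq\hat G_2$ are measurable. Then $$U\otimes V:H\otimes K\to L^2(E\oplus F,\ \lambda\times\mu\,|\,E\oplus F)$$ is a decomposition operator of $\pi\otimes\sigma$.
   Context: A family $\{x_i\}$ in a Hilbert space $H$ is a frame if there are constants $0<A\le B<\infty$ with $A\|x\|^2\le\sum_i|\langle x,x_i\rangle|^2\le B\|x\|^2$ for all $x\in H$. For a discrete countable abelian group $G$ and a separable Hilbert space $H$, a unitary representation $\pi:G\to B(H)$ is a frame representation with frame vector $v\in H$ if $\{\pi(g)v: g\in G\}$ is a frame for $H$. Let $\hat G$ be the dual (character) group of $G$ with normalized Haar measure $\lambda$; each $g\in G$ is viewed as the function $\xi\mapsto g(\xi)=\xi(g)$ on $\hat G$. There is a spectral measure $P$ on $\hat G$ with values in $B(H)$ such that $\pi(g)=\int_{\hat G}g(\xi)\,dP(\xi)$. A decomposition operator of the frame representation $\pi$ is a unitary operator $U:H\to L^2(E,\lambda|E)$, where $E\subseteq\hat G$ is measurable with $\lambda(E)>0$ and $\lambda|E$ is the restriction of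 $\lambda$, that intertwines the spectral measure $P$ on $H$ with the canonical spectral measure (multiplication by indicator functions) on $L^2(E,\lambda|E)$; equivalently, $U^*M_gU=\pi(g)$ for all $g\in G$, where $M_g$ is multiplication by $g$. The representation $\pi\otimes\sigma$ of $G_1\oplus G_2$ on the Hilbert space tensor product $H\otimes K$ is $(\pi\otimes\sigma)(g,h)=\pi(g)\otimes\sigma(h)$; it is a frame representation with frame vector $v\otimes w$. The dual $(G_1\oplus G_2)^\wedge$ is identified with $\hat G_1\oplus\hat G_2$, $E\oplus F$ denotes $\{(\zeta,\eta):\zeta\in E,\eta\in F\}$, $\lambda\times\mu$ is the product measure, and $L^2(E,\lambda|E)\otimes L^2(F,\mu|F)$ is identified with $L^2(E\oplus F,\lambda\times\mu|E\oplus F)$ via $(\phi\otimes\psi)(\zeta,\eta)=\phi(\zeta)\psi(\eta)$. *)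

(* Defs.v *)
From HB Require Import structures.
From mathcomp Require Import all_boot all_order all_algebra.
From mathcomp Require Import sesquilinear.
From mathcomp Require Import complex.
From mathcomp Require Import all_classical all_reals all_analysis.
From mathcomp Require Import measurable_realfun.
From mathcomp Require Import ring lra.
Set Implicit Arguments.
Unset Strict Implicit.
Unset Printing Implicit Defensive.
Import Order.TTheory GRing.Theory Num.Theory.
Import numFieldNormedType.Exports.
Local Open Scope classical_set_scope.
Local Open Scope ring_scope.

Section dual.
Variables (R : realType) (G : zmodType).

(* The characters of G, with the topology of pointwise convergence (which is the
   compact-open one, G being discrete) and its Borel sigma-algebra. *)
Record dual := Dual {
  dual_fun :> G -> R[i] ;
  dualD : forall g h, dual_fun (g + h) = dual_fun g * dual_fun h ;
  dual_norm : forall g, `|dual_fun g| = 1 }.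

HB.instance Definition _ := gen_eqMixin dual.
HB.instance Definition _ := gen_choiceMixin dual.

Lemma dualP (x y : dual) : (forall g, x g = y g) -> x = y.
Proof.
case: x y => [x xD x1] [y yD y1] /= /funext xy; subst y.
by rewrite (Prop_irrelevance xD yD) (Prop_irrelevance x1 y1).
Qed.

Definition dual1 : dual.
Proof. by exists (fun=> 1) => [g h|g]; rewrite ?mulr1 ?normr1. Defined.

HB.instance Definition _ := isPointed.Build dual dual1.

Definition dual_mul (x y : dual) : dual.
Proof.
exists (fun g => x g * y g) => [g h|g].
  by rewrite !dualD mulrACA.
by rewrite normrM !dual_norm mulr1.
Defined.

HB.instance Definition _ := Topological.copy dual
  (initial_topology (fun x : dual => (x : G -> R[i]) : {ptws G -> (R[i])^o})).
HB.instance Definition _ := Measurable.copy dual (g_sigma_algebraType (@open dual)).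

End dual.

HB.instance Definition _ (G1 G2 : countZmodType) := GRing.Zmodule.on (G1 * G2)%type.

(* R[i] carries no sigma-algebra in the library. *)
Definition measurable_cfun d (T : measurableType d) (R : realType)
    (f : T -> R[i]) :=
  measurable_fun setT (fun x => complex.Re (f x)) /\
  measurable_fun setT (fun x => complex.Im (f x)).

Section dual_measurability.
Variables (R : realType) (G : countZmodType).
Local Open Scope complex_scope.

Let box (b : rat * rat * (rat * rat)) : set R[i] :=
  [set z | [/\ ratr b.1.1 < complex.Re z, complex.Re z < ratr b.1.2,
               ratr b.2.1 < complex.Im z & complex.Im z < ratr b.2.2]].

Let box_ball (z : R[i]) (e : R) : 0 < e ->
  exists2 b, box b z & box b `<=` ball (z : R[i]^o) e%:C.
Proof.
move=> e0; have e20 : 0 < e / 2 by rewrite divr_gt0.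
have near_rat (x : R) : exists a b : rat,
    [/\ x - e / 2 < ratr a, ratr a < x, x < ratr b & ratr b < x + e / 2].
  have /rat_in_itvoo[a] : x - e / 2 < x by rewrite ltrBlDr ltrDl.
  have /rat_in_itvoo[b] : x < x + e / 2 by rewrite ltrDl.
  rewrite !in_itv/= => /andP[? ?] /andP[? ?]; by exists a, b.
have [a [b [? ? ? ?]]] := near_rat (complex.Re z).
have [c [d [? ? ? ?]]] := near_rat (complex.Im z).
exists (a, b, (c, d)) => //= w [/= aw wb cw wd].
rewrite /ball/= /ball_/= normc_def ltcR.
have -> : e = Num.sqrt (e ^+ 2) by rewrite sqrtr_sqr gtr0_norm.
rewrite ltr_sqrt ?exprn_gt0//.
have [ez1 ez2] : `|complex.Re (z - w)| < e / 2 /\ `|complex.Im (z - w)| < e / 2.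
  rewrite !raddfB/= !ltr_norml; split; lra.
rewrite -(real_normK (num_real (complex.Re _))) -(real_normK (num_real (complex.Im _))).
apply: (@lt_trans _ _ ((e / 2) ^+ 2 + (e / 2) ^+ 2)).
  by rewrite ltrD// ltr_pXn2r// ?nnegrE// ltW.
nra.
Qed.

Let cyl (s : seq (G * (rat * rat * (rat * rat)))) : set (G -> R[i]) :=
  [set f | forall e, e \in s -> box e.2 (f e.1)].

Let cyl_filter (f : G -> R[i]) :
  Filter (filter_from [set s | cyl s f] cyl).
Proof.
apply: filter_from_filter; first by exists [::].
move=> s t sf tf; exists (s ++ t).
  by move=> e; rewrite mem_cat => /orP[/sf|/tf].
by move=> h hst; split=> e es; apply: hst; rewrite mem_cat es ?orbT.
Qed.

Let cyl_cvg (f : {ptws G -> R[i]^o}) :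
  filter_from [set s | cyl s f] cyl --> f.
Proof.
have FF := cyl_filter f.
apply/cvg_sup => g A /=.
have /= -> := @nbhsE (initial_topology (fun h : G -> R[i]^o => h g)) f.
move=> -[_ [[V oV <-] Vfg]] /= /filterS; apply.
have /nbhs_ballP[e /= e0 eV] : nbhs (f g : R[i]^o) V by exact: open_nbhs_nbhs.
have eE : e = (complex.Re e)%:C by rewrite RRe_real// gtr0_real.
have [|b bf bV] := @box_ball (f g) (complex.Re e).
  by move: e0; rewrite {1}eE ltcR.
exists [:: (g, b)].
  by move=> _ /[!inE] /eqP ->.
by move=> h /(_ (g, b)); rewrite mem_head => /(_ isT)/= /bV; rewrite -eE => /eV.
Qed.

Lemma measurable_fun_dual d (T : measurableType d) (F : T -> dual R G) :
  (forall g, measurable_cfun (fun x => F x g)) -> measurable_fun setT F.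
Proof.
move=> mF.
have mcyl s : measurable [set x | cyl s (F x)].
  have -> : [set x | cyl s (F x)] = \bigcap_(i in [set` s]) [set x | box i.2 (F x i.1)].
    by apply/seteqP; split.
  apply: fin_bigcap_measurable => // -[g [[a b] [c d']]] _.
  have [mre mim] := mF g.
  have -> : [set x | box (a, b, (c, d')) (F x g)] =
     ((fun x => complex.Re (F x g)) @^-1` `]ratr a, ratr b[%classic) `&`
     ((fun x => complex.Im (F x g)) @^-1` `]ratr c, ratr d'[%classic).
    apply/seteqP; split=> x; rewrite /= !in_itv/=.
      by case=> -> -> -> ->.
    by move=> [/andP[? ?] /andP[? ?]].
  by apply: measurableI; rewrite -[X in measurable X]setTI; [apply: mre|apply: mim].
apply: (@measurability _ _ _ _ _ _ (@open (dual R G))) => //.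
move=> _ [_ [W oW <-] <-]; rewrite setTI.
pose P s := cyl s `<=` W.
rewrite [X in measurable X](_ : _ =
    \bigcup_s (if `[< P s >] then [set x | cyl s (F x)] else set0)).
  apply: countable_bigcupT_measurable; first exact: countableP.
  by move=> s; case: asboolP.
apply/seteqP; split=> x /=.
  move=> WFx; have /cyl_cvg[s sF sW] : nbhs (F x : {ptws G -> R[i]^o}) W.
    exact: open_nbhs_nbhs.
  by exists s => //; case: asboolP.
by case=> s _; case: asboolP => // sW /sW.
Qed.

End dual_measurability.

Section dual_pair.
Variables (R : realType) (G1 G2 : countZmodType).

Let ball_le (z w : R[i]) (e : R) : ball (z : R[i]^o) (e%:C)%C w ->
  `|complex.Re (z - w)| < e /\ `|complex.Im (z - w)| < e.
Proof.
rewrite /ball/= /ball_/= normc_def ltcR => zwe.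
split; apply: le_lt_trans zwe; rewrite -sqrtr_sqr ler_wsqrtr//.
  by rewrite lerDl sqr_ge0.
by rewrite lerDr sqr_ge0.
Qed.

Let Re_continuous : continuous (fun z : R[i]^o => complex.Re z : R^o).
Proof.
move=> z A /nbhs_ballP[e /= e0 eA].
suff : nbhs (z : R[i]^o) [set w | A (complex.Re w)] by [].
apply/nbhs_ballP; exists (e%:C)%C => /=; first by rewrite ltcR.
move=> w zw; have [{}zw _] := ball_le zw; apply: eA.
by rewrite /ball/= /ball_/= -raddfB.
Qed.

Let Im_continuous : continuous (fun z : R[i]^o => complex.Im z : R^o).
Proof.
move=> z A /nbhs_ballP[e /= e0 eA].
suff : nbhs (z : R[i]^o) [set w | A (complex.Im w)] by [].
apply/nbhs_ballP; exists (e%:C)%C => /=; first by rewrite ltcR.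
move=> w zw; have [_ {}zw] := ball_le zw; apply: eA.
by rewrite /ball/= /ball_/= -raddfB.
Qed.

Lemma dual_eval_continuous (G : zmodType) (g : G) :
  continuous (fun x : dual R G => x g : R[i]^o).
Proof.
move=> x.
pose e := fun x : dual R G => x : {ptws G -> R[i]^o}.
have : continuous e by exact: initial_continuous.
move=> ce A /(@proj_continuous G (fun=> R[i]^o) g (e x)).
exact: ce.
Qed.

Lemma measurable_dual_eval (G : zmodType) (g : G) :
  measurable_cfun (fun x : dual R G => x g).
Proof.
have mopen (f : R[i]^o -> R^o) : continuous f ->
    measurable_fun setT (fun x : dual R G => (f (x g) : R)).
  move=> cf; apply: (measurability _ (RGenOInfty.measurableE R)) => //.
  move=> _ [_ [r ->] <-]; rewrite setTI; apply: sub_sigma_algebra => /=.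
  apply: (@open_comp _ _ (fun x : dual R G => f (x g)) `]r, +oo[%classic).
    move=> x _.
    exact: (continuous_comp (@dual_eval_continuous _ g x) (cf _)).
  exact: interval_open.
by split; apply: mopen.
Qed.

Definition dual_pair_fun (x : dual R G1 * dual R G2) (g : G1 * G2) :=
  x.1 g.1 * x.2 g.2.

Lemma dual_pair_funD x g h :
  dual_pair_fun x (g + h) = dual_pair_fun x g * dual_pair_fun x h.
Proof. by rewrite /dual_pair_fun !dualD mulrACA. Qed.

Lemma dual_pair_fun_norm x g : `|dual_pair_fun x g| = 1.
Proof. by rewrite normrM !dual_norm mulr1. Qed.

Definition dual_pair (x : dual R G1 * dual R G2) : dual R (G1 * G2)%type :=
  Dual (dual_pair_funD x) (dual_pair_fun_norm x).

Definition dual_fst (x : dual R (G1 * G2)%type) : dual R G1.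
Proof.
exists (fun g => x (g, 0)) => [g h|g]; last exact: dual_norm.
by rewrite -dualD; congr (x (_, _)); rewrite addr0.
Defined.

Definition dual_snd (x : dual R (G1 * G2)%type) : dual R G2.
Proof.
exists (fun g => x (0, g)) => [g h|g]; last exact: dual_norm.
by rewrite -dualD; congr (x (_, _)); rewrite addr0.
Defined.

Lemma dual0 (G : zmodType) (x : dual R G) : x 0 = 1.
Proof.
have x0 : x 0 != 0 by rewrite -normr_eq0 dual_norm oner_eq0.
by apply: (mulfI x0); rewrite -dualD addr0 mulr1.
Qed.

Lemma dual_pairK : cancel dual_pair (fun x => (dual_fst x, dual_snd x)).
Proof.
by move=> [x y]; congr pair; apply: dualP => g;
  rewrite /= /dual_pair_fun dual0 ?mulr1 ?mul1r.
Qed.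

Lemma dual_fst_sndK : cancel (fun x => (dual_fst x, dual_snd x)) dual_pair.
Proof.
move=> x; apply: dualP => -[g h]; rewrite /= /dual_pair_fun/= -dualD.
by congr (x (_, _)); rewrite ?addr0 ?add0r.
Qed.

Lemma measurable_dual_fst : measurable_fun setT dual_fst.
Proof. by apply: measurable_fun_dual => g; exact: measurable_dual_eval. Qed.

Lemma measurable_dual_snd : measurable_fun setT dual_snd.
Proof. by apply: measurable_fun_dual => g; exact: measurable_dual_eval. Qed.

Lemma measurable_dual_pair : measurable_fun setT dual_pair.
Proof.
apply: measurable_fun_dual => g.
have [re1 im1] := @measurable_dual_eval G1 g.1.
have [re2 im2] := @measurable_dual_eval G2 g.2.
have Mre1 := measurableT_comp re1 (@measurable_fst _ _ (dual R G1) (dual R G2)).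
have Mim1 := measurableT_comp im1 (@measurable_fst _ _ (dual R G1) (dual R G2)).
have Mre2 := measurableT_comp re2 (@measurable_snd _ _ (dual R G1) (dual R G2)).
have Mim2 := measurableT_comp im2 (@measurable_snd _ _ (dual R G1) (dual R G2)).
have ReM (z w : R[i]) : complex.Re (z * w) =
    complex.Re z * complex.Re w - complex.Im z * complex.Im w.
  by case: z => ? ?; case: w.
have ImM (z w : R[i]) : complex.Im (z * w) =
    complex.Re z * complex.Im w + complex.Im z * complex.Re w.
  by case: z => ? ?; case: w.
split; rewrite /= /dual_pair_fun.
- under eq_fun do rewrite ReM.
  by apply: measurable_funB; apply: measurable_funM.
- under eq_fun do rewrite ImM.
  by apply: measurable_funD; apply: measurable_funM.
Qed.

HB.instance Definition _ :=
  isMeasurableFun.Build _ _ _ _ dual_pair measurable_dual_pair.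

(* The image of the product measure under the identification dual_pair of the
   product of the dual groups with the dual of the product. *)
Definition dual_prod_measure (lam : probability (dual R G1) R)
    (mu : probability (dual R G2) R) : probability (dual R (G1 * G2)%type) R :=
  distribution (lam \x mu)%E dual_pair.

(* See dual_sumE. *)
Definition dual_sum (E : set (dual R G1)) (F : set (dual R G2)) :
    set (dual R (G1 * G2)%type) :=
  [set x | E (dual_fst x) /\ F (dual_snd x)].

Lemma measurable_dual_sum E F :
  measurable E -> measurable F -> measurable (dual_sum E F).
Proof.
move=> mE mF; apply: measurableI; rewrite -[X in measurable X]setTI.
  exact: measurable_dual_fst.
exact: measurable_dual_snd.
Qed.

Lemma dual_sumE E F : dual_sum E F = dual_pair @` (E `*` F).
Proof.
apply/seteqP; split=> [x [Ex Fx]|_ [[x y] [/= Ex Fy] <-]].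
  by exists (dual_fst x, dual_snd x) => //; exact: dual_fst_sndK.
by have [xE yE] := dual_pairK (x, y); rewrite /dual_sum/= xE yE.
Qed.

End dual_pair.

Section L2_space.
Context d (T : measurableType d) (R : realType) (m : {measure set T -> \bar R}).
Local Open Scope complex_scope.
Implicit Types f g h : T -> R[i].

Definition cint (f : T -> R[i]) : R[i] :=
  (\int[m]_x complex.Re (f x)) +i* (\int[m]_x complex.Im (f x)).

(* |z|^2 as a real number, see add_Re2_Im2. *)
Definition sqmod (z : R[i]) : R := complex.Re z ^+ 2 + complex.Im z ^+ 2.

Definition sqintegrable (f : T -> R[i]) :=
  measurable_cfun f /\ (\int[m]_x (sqmod (f x))%:E < +oo)%E.

Definition cintegrable f :=
  m.-integrable setT (fun x => (complex.Re (f x))%:E) /\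
  m.-integrable setT (fun x => (complex.Im (f x))%:E).

Lemma ReM (z w : R[i]) : complex.Re (z * w) =
  complex.Re z * complex.Re w - complex.Im z * complex.Im w.
Proof. by case: z => ? ?; case: w. Qed.

Lemma ImM (z w : R[i]) : complex.Im (z * w) =
  complex.Re z * complex.Im w + complex.Im z * complex.Re w.
Proof. by case: z => ? ?; case: w. Qed.

Lemma ReD (z w : R[i]) : complex.Re (z + w) = complex.Re z + complex.Re w.
Proof. by case: z => ? ?; case: w. Qed.

Lemma ImD (z w : R[i]) : complex.Im (z + w) = complex.Im z + complex.Im w.
Proof. by case: z => ? ?; case: w. Qed.

Lemma Re_conj (z : R[i]) : complex.Re (Num.conj z) = complex.Re z.
Proof. by case: z. Qed.

Lemma Im_conj (z : R[i]) : complex.Im (Num.conj z) = - complex.Im z.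
Proof. by case: z. Qed.

Lemma sqmod_ge0 z : 0 <= sqmod z.
Proof. by rewrite addr_ge0// sqr_ge0. Qed.

Lemma measurable_cfunD f g :
  measurable_cfun f -> measurable_cfun g -> measurable_cfun (f + g).
Proof.
move=> [f1 f2] [g1 g2]; split.
- by under eq_fun do rewrite /= ReD; exact: measurable_funD.
- by under eq_fun do rewrite /= ImD; exact: measurable_funD.
Qed.

Lemma measurable_cfunM f g :
  measurable_cfun f -> measurable_cfun g -> measurable_cfun (fun x => f x * g x).
Proof.
move=> [f1 f2] [g1 g2]; split.
- under eq_fun do rewrite ReM.
  by apply: measurable_funB; exact: measurable_funM.
- under eq_fun do rewrite ImM.
  by apply: measurable_funD; exact: measurable_funM.
Qed.

Lemma measurable_cfun_cst (a : R[i]) : measurable_cfun (fun _ : T => a).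
Proof. by split; exact: measurable_cst. Qed.

Lemma measurable_cfun_conj f :
  measurable_cfun f -> measurable_cfun (fun x => Num.conj (f x)).
Proof.
move=> [f1 f2]; split; first by under eq_fun do rewrite Re_conj.
by under eq_fun do rewrite Im_conj; exact: measurableT_comp.
Qed.

Lemma measurable_sqmod f :
  measurable_cfun f -> measurable_fun setT (fun x => sqmod (f x)).
Proof.
by move=> [f1 f2]; apply: measurable_funD; exact: measurable_funX.
Qed.

Lemma integrable_sqmod f : sqintegrable f ->
  m.-integrable setT (fun x => (sqmod (f x))%:E).
Proof.
move=> [mf lf]; apply/integrableP; split.
  by apply/measurable_EFinP; exact: measurable_sqmod.
by under eq_integral do rewrite gee0_abs ?lee_fin ?sqmod_ge0//.
Qed.

Lemma le_integrable_sqmod f g (k : T -> R) : sqintegrable f -> sqintegrable g ->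
  measurable_fun setT k -> (forall x, `|k x| <= sqmod (f x) + sqmod (g x)) ->
  m.-integrable setT (fun x => (k x)%:E).
Proof.
move=> If Ig mk kfg.
apply: (@le_integrable _ _ _ _ _ _ _
  (fun x => (sqmod (f x))%:E + (sqmod (g x))%:E)%E) => //.
- exact/measurable_EFinP.
- move=> x _; rewrite -EFinD !abse_EFin lee_fin.
  by rewrite (ger0_norm (addr_ge0 _ _))// sqmod_ge0.
- by apply: integrableD => //; exact: integrable_sqmod.
Qed.

Lemma cintegrable_mul_conj f g : sqintegrable f -> sqintegrable g ->
  cintegrable (fun x => f x * Num.conj (g x)).
Proof.
move=> If Ig; have [mf _] := If; have [mg _] := Ig.
have [? ?] := measurable_cfunM mf (measurable_cfun_conj mg).
split; apply: (le_integrable_sqmod If Ig) => // x.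
- rewrite ReM Re_conj Im_conj ler_norml /sqmod.
  set a := complex.Re (f x); set b := complex.Im (f x).
  set p := complex.Re (g x); set q := complex.Im (g x).
  have := sqr_ge0 (a + p); have := sqr_ge0 (b + q).
  have := sqr_ge0 (a - p); have := sqr_ge0 (b - q).
  have := sqr_ge0 (a + q); have := sqr_ge0 (b + p).
  rewrite !expr2 => *; apply/andP; split; nra.
- rewrite ImM Re_conj Im_conj ler_norml /sqmod.
  set a := complex.Re (f x); set b := complex.Im (f x).
  set p := complex.Re (g x); set q := complex.Im (g x).
  have := sqr_ge0 (a + q); have := sqr_ge0 (b + p).
  have := sqr_ge0 (a - q); have := sqr_ge0 (b - p).
  have := sqr_ge0 a; have := sqr_ge0 b; have := sqr_ge0 p; have := sqr_ge0 q.
  rewrite !expr2 => *; apply/andP; split; nra.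
Qed.

Lemma cint_linear (a : R[i]) f g : cintegrable f -> cintegrable g ->
  cint (fun x => a * f x + g x) = a * cint f + cint g.
Proof.
move=> [f1 f2] [g1 g2].
have Z (c : R) (k : T -> R) : m.-integrable setT (fun x => (k x)%:E) ->
    m.-integrable setT (fun x => (c * k x)%:E).
  move=> ik; rewrite (_ : (fun x => _) = (fun x => c%:E * (k x)%:E)%E)//.
  exact: integrableZl.
have D (k l : T -> R) : m.-integrable setT (fun x => (k x)%:E) ->
    m.-integrable setT (fun x => (l x)%:E) ->
    m.-integrable setT (fun x => (k x + l x)%:E).
  move=> ik il; rewrite (_ : (fun x => _) = (fun x => (k x)%:E + (l x)%:E)%E)//.
  exact: integrableD.
rewrite /cint; apply/eqP; rewrite eq_complex; apply/andP; split; apply/eqP.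
- rewrite ReD ReM/=.
  under eq_Rintegral do rewrite ReD ReM -mulNr.
  rewrite !RintegralD//; last 3 first.
  + exact: Z.
  + exact: Z.
  + by apply: D; exact: Z.
  by rewrite !RintegralZl// mulNr.
- rewrite ImD ImM/=.
  under eq_Rintegral do rewrite ImD ImM.
  rewrite !RintegralD//; last 3 first.
  + exact: Z.
  + exact: Z.
  + by apply: D; exact: Z.
  by rewrite !RintegralZl.
Qed.

Lemma cint_conj f : cintegrable f ->
  cint (fun x => Num.conj (f x)) = Num.conj (cint f).
Proof.
move=> [f1 f2]; rewrite /cint; apply/eqP; rewrite eq_complex.
rewrite Re_conj Im_conj /=; apply/andP; split; apply/eqP.
  by apply: eq_Rintegral => x _; rewrite Re_conj.
rewrite -mulN1r -RintegralZl//; apply: eq_Rintegral => x _.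
by rewrite Im_conj mulN1r.
Qed.

Lemma cint_ae f g : measurable_cfun f -> measurable_cfun g ->
  f = g %[ae m] -> cint f = cint g.
Proof.
move=> [f1 f2] [g1 g2] fg; rewrite /cint /Rintegral; congr (_ +i* _); congr fine.
  apply: ae_eq_integral => //; [exact/measurable_EFinP..|].
  by apply: filterS fg => x /= + /[dup] => /[apply] ->.
apply: ae_eq_integral => //; [exact/measurable_EFinP..|].
by apply: filterS fg => x /= + /[dup] => /[apply] ->.
Qed.

Definition sqint : {pred T -> R[i]} := fun f => `[< sqintegrable f >].

Lemma sqintP (a : R[i]) f g : f \in sqint -> g \in sqint ->
  (fun x => a * f x + g x) \in sqint.
Proof.
move=> /asboolP If /asboolP Ig; apply/asboolP.
have [mf lf] := If; have [mg lg] := Ig.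
have mafg : measurable_cfun (fun x => a * f x + g x).
  by apply: measurable_cfunD => //; exact: (measurable_cfunM (measurable_cfun_cst a)).
split=> //.
pose c := 2 * sqmod a; have c0 : 0 <= c by rewrite mulr_ge0// sqmod_ge0.
apply: (@le_lt_trans _ _
  (\int[m]_x (c%:E * (sqmod (f x))%:E + 2%:E * (sqmod (g x))%:E))%E).
  apply: ge0_le_integral => //.
  - by move=> x _; rewrite lee_fin sqmod_ge0.
  - by apply/measurable_EFinP; exact: measurable_sqmod.
  - apply: emeasurable_funD; apply/measurable_EFinP; apply: measurable_funM => //;
      exact: measurable_sqmod.
  - move=> x _; rewrite -!EFinM -EFinD lee_fin.
    rewrite /c /sqmod ReD ImD ReM ImM.
    set p := complex.Re a; set q := complex.Im a.
    set u := complex.Re (f x); set v := complex.Im (f x).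
    set s := complex.Re (g x); set t := complex.Im (g x).
    have := sqr_ge0 (p * u - q * v - s); have := sqr_ge0 (p * v + q * u - t).
    nra.
rewrite ge0_integralD//; last 4 first.
- by move=> x _; rewrite -EFinM lee_fin mulr_ge0// sqmod_ge0.
- apply/measurable_EFinP; apply: measurable_funM => //; exact: measurable_sqmod.
- by move=> x _; rewrite -EFinM lee_fin mulr_ge0// sqmod_ge0.
- apply/measurable_EFinP; apply: measurable_funM => //; exact: measurable_sqmod.
rewrite !integralZl//; [|exact: integrable_sqmod..].
by rewrite lte_add_pinfty// lte_mul_pinfty// lee_fin.
Qed.

Lemma sqint0 : (fun=> 0) \in sqint.
Proof.
apply/asboolP; split; first exact: measurable_cfun_cst.
by rewrite integral0_eq ?ltry// => x _; rewrite /sqmod/= expr0n addr0.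
Qed.

Lemma sqint_zmod_closed : zmod_closed sqint.
Proof.
split; first exact: sqint0.
move=> f g sf sg; rewrite (_ : f - g = fun x => -1 * g x + f x) ?sqintP//.
by apply/funext => x; rewrite mulN1r addrC.
Qed.

HB.instance Definition _ := GRing.isZmodClosed.Build _ sqint sqint_zmod_closed.

Record L2fun := L2Fun {
  L2fun_fun :> T -> R[i] ;
  L2funP : L2fun_fun \in sqint }.

HB.instance Definition _ := [isSub for L2fun_fun].
HB.instance Definition _ := [Choice of L2fun by <:].
HB.instance Definition _ := [SubChoice_isSubZmodule of L2fun by <:].

Lemma L2funB (f g : L2fun) x : (f - g) x = f x - g x.
Proof. by rewrite -[LHS]/(\val (f - g) x) raddfB. Qed.

Lemma L2funD (f g : L2fun) x : (f + g) x = f x + g x.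
Proof. by rewrite -[LHS]/(\val (f + g) x) raddfD. Qed.

Lemma sqint_scale (a : R[i]) (f : L2fun) : (fun x => a * f x) \in sqint.
Proof.
rewrite (_ : (fun x => _) = fun x => a * f x + 0).
  exact: (sqintP a (L2funP f) sqint0).
by apply/funext => x; rewrite addr0.
Qed.

Definition L2fun_scale (a : R[i]) (f : L2fun) := L2Fun (sqint_scale a f).

Definition L2null : {pred L2fun} :=
  fun f : L2fun => `[< \forall x \ae m, f x = 0 >].

Lemma L2null_zmod_closed : zmod_closed L2null.
Proof.
split; first by apply/asboolP; exact: aeW.
move=> f g /asboolP f0 /asboolP g0; apply/asboolP.
apply: filterS2 f0 g0 => x fx gx.
by rewrite L2funB fx gx subrr.
Qed.

HB.instance Definition _ := GRing.isZmodClosed.Build _ L2null L2null_zmod_closed.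

(* L^2(m): square integrable functions modulo almost everywhere equality, see
   L2_eqP. *)
Definition L2 := Quotient.quot L2null.
HB.instance Definition _ := GRing.Zmodule.on L2.

Lemma L2_eqP (f g : L2fun) :
  (\pi_L2 f = \pi_L2 g)%qT <-> \forall x \ae m, f x = g x.
Proof.
split=> [/eqP|fg].
  rewrite -[_ == _](Quotient.idealrBE L2null f g) => /asboolP.
  apply: filterS => x; rewrite L2funB => /eqP.
  by rewrite subr_eq0 => /eqP.
apply/eqP; rewrite -[_ == _](Quotient.idealrBE L2null f g).
apply/asboolP; apply: filterS fg => x fg.
by rewrite L2funB fg subrr.
Qed.

Definition L2_scale (a : R[i]) (u : L2) : L2 := (\pi_L2 (L2fun_scale a (repr u)))%qT.

Lemma L2_scaleE a (f : L2fun) :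
  L2_scale a (\pi_L2 f)%qT = (\pi_L2 (L2fun_scale a f))%qT.
Proof.
apply/L2_eqP; have : (\pi_L2 (repr (\pi_L2 f)) = \pi_L2 f)%qT by rewrite reprK.
by move=> /L2_eqP; apply: filterS => x /= ->.
Qed.

Lemma L2_scaleA a b u : L2_scale a (L2_scale b u) = L2_scale (a * b) u.
Proof.
elim/quotW: u => f; rewrite (L2_scaleE b) !L2_scaleE; apply/L2_eqP/aeW => x.
by rewrite /= mulrA.
Qed.

Lemma L2_scale1 : left_id 1 L2_scale.
Proof.
elim/quotW => f; rewrite !L2_scaleE; apply/L2_eqP/aeW => x.
by rewrite /= mul1r.
Qed.

Lemma L2_scaleDr : right_distributive L2_scale +%R.
Proof.
move=> a; elim/quotW=> f; elim/quotW=> g.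
rewrite -raddfD/= !L2_scaleE -raddfD/=.
apply/L2_eqP/aeW => x; rewrite L2funD.
exact: (etrans (congr1 ( *%R a) (L2funD f g x)) (mulrDr a (f x) (g x))).
Qed.

Lemma L2_scaleDl u : {morph L2_scale^~ u : a b / a + b}.
Proof.
move=> a b; elim/quotW: u => f; rewrite !L2_scaleE -raddfD/=.
by apply/L2_eqP/aeW => x; rewrite L2funD/= mulrDl.
Qed.

HB.instance Definition _ := GRing.Zmodule_isLmodule.Build R[i] L2
  L2_scaleA L2_scale1 L2_scaleDr L2_scaleDl.

Definition L2_dot (u v : L2) : R[i] :=
  cint (fun x => repr u x * Num.conj (repr v x)).

Lemma L2fun_sqint (f : L2fun) : sqintegrable f.
Proof. exact/asboolP/L2funP. Qed.

Lemma L2_dotE (f g : L2fun) :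
  L2_dot (\pi_L2 f)%qT (\pi_L2 g)%qT = cint (fun x => f x * Num.conj (g x)).
Proof.
have E (k : L2fun) : \forall x \ae m, repr (\pi_L2 k)%qT x = k x.
  by apply/L2_eqP; rewrite reprK.
have M (k l : L2fun) : measurable_cfun (fun x => k x * Num.conj (l x)).
  apply: measurable_cfunM; first by have [] := L2fun_sqint k.
  by apply: measurable_cfun_conj; have [] := L2fun_sqint l.
apply: cint_ae => //; apply: filterS2 (E f) (E g) => x fx gx _.
by rewrite fx gx.
Qed.

Lemma L2_dot_herm u v : L2_dot u v = (-1) ^+ false * Num.conj (L2_dot v u).
Proof.
rewrite expr0 mul1r -cint_conj; last first.
  by apply: cintegrable_mul_conj; exact: L2fun_sqint.
by congr cint; apply/funext => x; rewrite rmorphM/= conjCK mulrC.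
Qed.

Lemma L2_dot_linearl w : linear_for *%R (L2_dot^~ w).
Proof.
move=> a; elim/quotW=> f; elim/quotW=> g; elim/quotW: w => h.
rewrite [a *: _]L2_scaleE -raddfD/= !L2_dotE -cint_linear//; last 2 first.
  by apply: cintegrable_mul_conj; exact: L2fun_sqint.
  by apply: cintegrable_mul_conj; exact: L2fun_sqint.
by congr cint; apply/funext => x; rewrite L2funD/= mulrDl mulrA.
Qed.

Lemma L2_dot_linearr u : linear_for (Num.conj \; *%R) (L2_dot u).
Proof.
move=> a v w; rewrite L2_dot_herm L2_dot_linearl [L2_dot u v]L2_dot_herm.
by rewrite [L2_dot u w]L2_dot_herm !expr0 !mul1r rmorphD rmorphM.
Qed.

HB.instance Definition _ := bilinear_isBilinear.Build R[i] L2 L2 R[i]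
  *%R (Num.conj \; *%R) L2_dot (L2_dot_linearl, L2_dot_linearr).

HB.instance Definition _ :=
  isHermitianSesquilinear.Build R[i] L2 false Num.conj L2_dot L2_dot_herm.

Lemma L2_dot_gt0 u : u != 0 -> 0 < L2_dot u u.
Proof.
elim/quotW: u => f f0; rewrite L2_dotE.
have ffE x : f x * Num.conj (f x) = (sqmod (f x))%:C.
  by rewrite -normCK -add_Re2_Im2.
have -> : cint (fun x => f x * Num.conj (f x)) = (\int[m]_x sqmod (f x))%:C.
  rewrite /cint; congr (_ +i* _); first by apply: eq_Rintegral => x _; rewrite ffE.
  by rewrite (@eq_Rintegral _ _ _ _ _ (fun=> 0)) ?Rintegral_cst ?mul0r// => x _; rewrite ffE.
rewrite ltcR lt_neqAle; apply/andP; split; last first.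
  by apply: Rintegral_ge0 => x _; exact: sqmod_ge0.
apply: contra_neq f0 => /esym /eqP; have [mf lf] := L2fun_sqint f.
rewrite /Rintegral fine_eq0; last first.
  rewrite ge0_fin_numE//; apply: integral_ge0 => x _.
  by rewrite lee_fin sqmod_ge0.
move=> /eqP i0.
have -> : 0 = (\pi_L2 0)%qT :> L2 by rewrite raddf0.
apply/L2_eqP.
have : ae_eq m setT (fun x => (sqmod (f x))%:E) (cst 0%E).
  apply/ae_eq_integral_abs => //.
    by apply/measurable_EFinP; exact: measurable_sqmod.
  by rewrite -[RHS]i0; apply: eq_integral => x _; rewrite gee0_abs ?lee_fin ?sqmod_ge0.
apply: filterS => x /(_ Logic.I)[] /eqP.
rewrite /sqmod paddr_eq0 ?sqr_ge0// !sqrf_eq0 => /andP[/eqP re0 /eqP im0].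
by apply/eqP; rewrite eq_complex re0 im0 !eqxx.
Qed.

HB.instance Definition _ := isDotProduct.Build R[i] L2 L2_dot L2_dot_gt0.

(* The class of f in L^2(m); a function that is not square integrable is sent
   to 0, which does not happen for the functions considered below. *)
Definition L2_class (f : T -> R[i]) : L2 := (\pi_L2 (insubd (0 : L2fun) f))%qT.

Definition L2_mul_indic (A : set T) (u : L2) : L2 :=
  L2_class (fun x => (\1_A x)%:C * repr u x).

End L2_space.

Arguments L2_dot {d T R} m u v.
Arguments L2_class {d T R} m f.

Section hilbert_spaces.
Variable R : realType.
Implicit Types (U V : lmodType R[i]) (H : completeNormedModType R[i]).

(* H is a Hilbert space for the inner product dH, linear on the left. *)
Definition hilbert_dot H (dH : {dot H for Num.conj}) :=
  forall x, dH x x = `|x| ^+ 2.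

Definition separable H := exists2 D : set H, countable D & dense D.

Definition sqnorm U (dU : {dot U for Num.conj}) (x : U) : R :=
  complex.Re (dU x x).

Definition unitary U V (dU : {dot U for Num.conj}) (dV : {dot V for Num.conj})
    (f : U -> V) :=
  [/\ linear f, forall x y, dV (f x) (f y) = dU x y
    & forall y, exists x, f x = y].

Definition bounded_linear U V (dU : {dot U for Num.conj})
    (dV : {dot V for Num.conj}) (f : U -> V) :=
  linear f /\ exists M : R, forall x, sqnorm dV (f x) <= M * sqnorm dU x.

Definition frame U (dU : {dot U for Num.conj}) (I : choiceType) (x : I -> U) :=
  exists A B : R, [/\ 0 < A, A <= B & forall y : U,
    ((A * sqnorm dU y)%:E <= \esum_(i in [set: I]) (sqmod (dU y (x i)))%:E /\
     \esum_(i in [set: I]) (sqmod (dU y (x i)))%:E <= (B * sqnorm dU y)%:E)%E].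

Definition unitary_representation (G : zmodType) H
    (dH : {dot H for Num.conj}) (pi : G -> H -> H) :=
  (forall g, unitary dH dH (pi g)) /\
  (forall g h x, pi (g + h) x = pi g (pi h x)).

(* The orbit of v is a frame as a family indexed by the group. *)
Definition frame_representation (G : zmodType) H (dH : {dot H for Num.conj})
    (pi : G -> H -> H) (v : H) :=
  unitary_representation dH pi /\ frame dH (fun g => pi g v).

Record spectral_measure d (X : measurableType d) H (dH : {dot H for Num.conj})
    (P : set X -> H -> H) : Prop := {
  spectral_linear : forall A, measurable A -> linear (P A) ;
  spectral_idem : forall A x, measurable A -> P A (P A x) = P A x ;
  spectral_selfadj : forall A x y, measurable A ->
    dH (P A x) y = dH x (P A y) ;
  spectralT : forall x, P setT x = x ;
  spectralI : forall A B x, measurable A -> measurable B ->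
    P (A `&` B) x = P A (P B x) ;
  spectral_sigma_additive : forall F : (set X)^nat,
    (forall n, measurable (F n)) -> trivIset setT F -> forall x,
    (\sum_(i < n) P (F i) x) @[n --> \oo] --> P (\bigcup_n F n) x }.

(* pi(g) is the integral of xi |-> xi g against P, in the weak sense: <pi(g)x, x>
   is the integral of xi g against the measure A |-> <P(A)x, x>; by polarization
   the diagonal scalar products determine pi(g). *)
Definition spectral_integral (G : zmodType) H (dH : {dot H for Num.conj})
    (pi : G -> H -> H) (P : set (dual R G) -> H -> H) :=
  forall x, exists2 m : {measure set (dual R G) -> \bar R},
    forall A, measurable A -> m A = (complex.Re (dH (P A x) x))%:E
    & forall g, dH (pi g x) x = cint m (fun xi => xi g).

(* The dual of a countable discrete group is compact and metrizable, so that a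
   Borel probability measure on it is regular; normalized Haar measure is the
   translation-invariant one. *)
Definition normalized_haar (G : zmodType) (lam : probability (dual R G) R) :=
  forall (xi : dual R G) (A : set (dual R G)), measurable A ->
    lam (dual_mul xi @^-1` A) = lam A.

Record decomposition_operator (G : zmodType) H (dH : {dot H for Num.conj})
    (pi : G -> H -> H) (lam : probability (dual R G) R)
    (E : set (dual R G)) (mE : measurable E) (U : H -> L2 (mrestr lam mE)) :
    Prop := {
  decomposition_frame : exists v, frame_representation dH pi v ;
  decomposition_haar : normalized_haar lam ;
  decomposition_gt0 : (0 < lam E)%E ;
  decomposition_unitary : unitary dH (L2_dot (mrestr lam mE)) U ;
  decomposition_spectral : exists P : set (dual R G) -> H -> H,
    [/\ spectral_measure dH P, spectral_integral dH pi P &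
        forall A x, measurable A -> U (P A x) = L2_mul_indic A (U x)] }.

(* HK, with t x y standing for the elementary tensor of x and y, is the Hilbert
   space tensor product of H and K: this determines HK up to a unique unitary. *)
Record hilbert_tensor (H K HK : completeNormedModType R[i])
    (dH : {dot H for Num.conj}) (dK : {dot K for Num.conj})
    (dHK : {dot HK for Num.conj}) (t : {bilinear H -> K -> HK}) : Prop := {
  tensor_dot : forall x x' y y', dHK (t x y) (t x' y') = dH x x' * dK y y' ;
  tensor_dense : dense [set z : HK | exists n (x : 'I_n -> H) (y : 'I_n -> K),
    z = \sum_(i < n) t (x i) (y i)] }.

(* The bounded operator A (x) B, determined by (A (x) B)(x (x) y) = Ax (x) By,
   where t and t' are the elementary tensors in the source and the target. *)
Definition tensor_op (H K HK H' K' L : lmodType R[i])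
    (dHK : {dot HK for Num.conj}) (dL : {dot L for Num.conj})
    (t : H -> K -> HK) (t' : H' -> K' -> L) (A : H -> H') (B : K -> K') :
    HK -> L :=
  xget (fun=> 0) [set W : HK -> L | bounded_linear dHK dL W /\
    forall x y, W (t x y) = t' (A x) (B y)].

Definition tensor_representation (G1 G2 : zmodType)
    (H K HK : completeNormedModType R[i]) (dHK : {dot HK for Num.conj})
    (t : H -> K -> HK) (pi : G1 -> H -> H) (sigma : G2 -> K -> K)
    (gh : G1 * G2) : HK -> HK :=
  tensor_op dHK dHK t t (pi gh.1) (sigma gh.2).

Variables G1 G2 : countZmodType.
Variables (lam : probability (dual R G1) R) (mu : probability (dual R G2) R).
Variables (E : set (dual R G1)) (F : set (dual R G2)).
Variables (mE : measurable E) (mF : measurable F).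

(* The function (zeta, eta) |-> u(zeta) v(eta) on the dual of G1 * G2. *)
Definition L2_tensor (u : L2 (mrestr lam mE)) (v : L2 (mrestr mu mF)) :
    L2 (mrestr (dual_prod_measure lam mu) (measurable_dual_sum mE mF)) :=
  L2_class _ (fun x => repr u (dual_fst x) * repr v (dual_snd x)).

End hilbert_spaces.

Arguments L2_tensor {R G1 G2 lam mu E F mE mF} u v.

(* Main.v *)
Require Import Defs.
From HB Require Import structures.
From mathcomp Require Import all_boot all_order all_algebra.
From mathcomp Require Import sesquilinear complex.
From mathcomp Require Import all_classical all_reals all_analysis.
From mathcomp Require Import measurable_realfun.
From mathcomp Require Import ring lra.
Import Order.TTheory GRing.Theory Num.Theory.
Import numFieldNormedType.Exports.
Local Open Scope classical_set_scope.
Local Open Scope ring_scope.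

(** A tensor product of unitary operators is unitary because the elementary tensors
span both sides with the same Gram matrix: the inner product of x (x) y and
x' (x) y' is the product of the two inner products, in H (x) K by definition and in
L^2(E (+) F) by Fubini's theorem. Mapping a linear combination of elementary tensors
to the same combination of their images is therefore an isometric linear relation.
Its closure is the graph of an isometry defined on the whole space as soon as the
source span is dense and the target is complete, and by symmetry it is onto as soon
as the target span is dense and the source is complete ([gram_extension],
[gram_unitary]). What this asks of L^2 is the Riesz--Fischer theorem ([L2_complete])
and the density of products of functions of one variable ([L2_product_dense]), which
a pi-lambda argument reduces to rectangles. The same extension result, with H (x) K
itself as target, shows that the tensor product of the two representations is unitary.

The orbit of v (x) w is a frame because every finite sum of elementary tensors can be
rewritten with orthogonal right factors. Pairing such a sum with an element of the
first frame leaves a vector of K whose squared norm splits along these factors, so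
that the bounds of the two frames multiply; they extend to all of H (x) K by density
([tensor_frame], [frame_dense]).

For the spectral part, the spectral measure of pi determines only the products of
pi(g)x with x, and these are the products of (xi |-> xi(g)) U x with U x, because the
diagonal measure of P at x has density |U x|^2. By polarization U pi(g) is
multiplication by the character g after U ([spectral_intertwining]), and likewise for
V and sigma. On elementary tensors, and then everywhere, U (x) V intertwines
pi(g) (x) sigma(h) with multiplication by the character (g, h). Carrying multiplication
by indicator functions back through U (x) V gives a spectral measure of the tensor
representation with the required intertwining property ([spectral_transport]). *)

Set Implicit Arguments.
Unset Strict Implicit.

(** * The squared norm of a dot product *)

Section sqnorm_theory.
Variables (R : realType) (L : lmodType R[i]) (d : {dot L for Num.conj}).
Local Open Scope complex_scope.
Local Notation N := (sqnorm d).

Lemma dot_sqnormE x : d x x = (N x)%:C.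
Proof. by rewrite /sqnorm RRe_real// ger0_real// dnorm_ge0. Qed.

Lemma sqnorm_ge0 x : 0 <= N x.
Proof. by rewrite -ler0c -dot_sqnormE dnorm_ge0. Qed.

Lemma sqnorm0 : N 0 = 0.
Proof. by rewrite /sqnorm linear0r. Qed.

Lemma sqnorm_eq0 x : N x = 0 -> x = 0.
Proof.
move=> x0; apply/eqP; rewrite -(dnorm_eq0 d); apply/eqP.
by rewrite dot_sqnormE x0.
Qed.

Lemma sqnorm_small x : (forall e, 0 < e -> N x <= e) -> x = 0.
Proof.
move=> h; apply: sqnorm_eq0; apply/eqP; rewrite eq_le sqnorm_ge0 andbT.
by apply/ler_addgt0Pr => e e0; rewrite add0r h.
Qed.

Lemma sqnormZ a x : N (a *: x) = sqmod a * N x.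
Proof.
rewrite /sqnorm linearZl_LR linearZr_LR/= mulrA dot_sqnormE.
by case: a => p q; rewrite /sqmod/= !mulr0 subr0 mulrN opprK -!expr2.
Qed.

Lemma sqnormN x : N (- x) = N x.
Proof. by rewrite /sqnorm hnormN. Qed.

Lemma sqnormBC x y : N (x - y) = N (y - x).
Proof. by rewrite -sqnormN opprB. Qed.

Lemma sqnormD x y : N (x + y) = N x + N y + complex.Re (d x y) *+ 2.
Proof.
rewrite /sqnorm dnormD !Defs.ReD Defs.Re_conj; ring.
Qed.

(** Young's inequality for the cross term: with e free it replaces the triangle
inequality between the square roots. *)
Lemma sqnormD_eps x y (e : R) : 0 < e ->
  N (x + y) <= (1 + e) * N x + (1 + e^-1) * N y.
Proof.
move=> e0; have := sqnorm_ge0 (e%:C *: x + (-1) *: y).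
rewrite (sqnormD (_ *: x)) !sqnormZ linearZl_LR linearZr_LR/= (sqnormD x).
have -> : sqmod (e%:C) = e ^+ 2 by rewrite /sqmod/= expr0n addr0.
have -> : sqmod (-1 : R[i]) = 1 by rewrite /sqmod/= oppr0 expr0n addr0 sqrrN expr1n.
have -> : complex.Re (e%:C * (Num.conj (-1) * d x y)) = - (e * complex.Re (d x y)).
  by rewrite rmorphN1 mulN1r mulrN raddfN/= Defs.ReM/= mul0r subr0.
set a := complex.Re _ => h.
have ei : e * e^-1 = 1 by rewrite divff// gt_eqF.
have := mulr_ge0 (ltW (_ : 0 < e^-1)) h; rewrite invr_gt0 => /(_ e0).
rewrite mul1r.
have -> : e^-1 * (e ^+ 2 * N x + N y + - (e * a) *+ 2) =
  (e * e^-1) * (e * N x) + e^-1 * N y - (e * e^-1) * a * 2 by ring.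
rewrite ei; lra.
Qed.

Lemma sqnormD_le x y : N (x + y) <= 2 * N x + 2 * N y.
Proof. by have := @sqnormD_eps x y 1 ltr01; rewrite invr1 -natr1. Qed.

Lemma sqnorm_tri x y z : N (x - z) <= 2 * N (x - y) + 2 * N (y - z).
Proof. by rewrite -(subrKA y) sqnormD_le. Qed.

(** Cauchy--Schwarz: the squared norm of N y times the component of x orthogonal to
y is N y times the difference of the two sides. *)
Lemma sqmod_dot x y : sqmod (d x y) <= N x * N y.
Proof.
have [y0|y0] := eqVneq y 0.
  by rewrite y0 linear0r sqnorm0 mulr0 /sqmod/= expr0n addr0.
have Ny : 0 < N y.
  rewrite lt_def sqnorm_ge0 andbT; apply: contra y0 => /eqP /sqnorm_eq0 ->.
  by rewrite eqxx.
have := sqnorm_ge0 ((N y)%:C *: x + (- d x y) *: y).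
rewrite sqnormD !sqnormZ linearZl_LR linearZr_LR/=.
case: (d x y) => p q; rewrite /sqmod/= !mul0r !subr0 !sqrrN expr0n addr0.
have -> : N y ^+ 2 * N x + (p ^+ 2 + q ^+ 2) * N y +
  N y * (- p * p - - - q * q) *+ 2 = N y * (N x * N y - (p ^+ 2 + q ^+ 2)) by ring.
by rewrite pmulr_rge0// subr_ge0.
Qed.

Lemma Im_dot x y : complex.Im (d x y) = complex.Re (d x ('i *: y)).
Proof. by rewrite linearZr_LR/= conjCi; case: (d x y) => p q /=; ring. Qed.

End sqnorm_theory.

(** * Closures of isometric relations *)

Section isometric_relation.
Variables (R : realType) (L1 L2 : lmodType R[i]).
Variables (d1 : {dot L1 for Num.conj}) (d2 : {dot L2 for Num.conj}).
Local Open Scope complex_scope.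
Local Notation N1 := (sqnorm d1).
Local Notation N2 := (sqnorm d2).

(** An inequality passes to the limit along approximations that are only known up
to Young's inequality: with s the square root of the approximation error, the error
terms and the factors 1 + s converge together. *)
Lemma relaxed_le_lim (C a b : R) : 0 <= C -> 0 <= b ->
  (forall e, 0 < e -> exists a' b', [/\ a' <= C * b',
     forall s, 0 < s -> a <= (1 + s) * a' + (1 + s^-1) * e
   & forall s, 0 < s -> b' <= (1 + s) * b + (1 + s^-1) * e]) ->
  a <= C * b.
Proof.
move=> C0 n0 h; apply/ler_addgt0Pr => e e0.
(* The error terms add up to at most s * (K + K). *)
pose K := (1 + C * (b + 1)) * 3.
have K0 : 0 < K.
  by rewrite mulr_gt0// ltr_wpDr// mulr_ge0// addr_ge0.
pose s := Num.min 1 (e / (K + K)).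
have s0 : 0 < s by rewrite lt_min ltr01 divr_gt0// addr_gt0.
have s1 : s <= 1 by rewrite ge_min lexx.
have sK : s * (K + K) <= e by rewrite -ler_pdivlMr ?addr_gt0// ge_min lexx orbT.
have si : s^-1 * s = 1 by rewrite mulVf// gt_eqF.
have [a' [b' [ab' /(_ s s0) Lx /(_ s s0) Ly]]] := h (s ^+ 2) (exprn_gt0 2 s0).
have E : (1 + s^-1) * s ^+ 2 = s ^+ 2 + s.
  by rewrite mulrDl mul1r expr2 mulrA si mul1r.
rewrite E in Lx Ly.
have ss : s ^+ 2 <= s by rewrite expr2 ger_pMr.
have B : a' <= C * ((1 + s) * b + (s ^+ 2 + s)).
  by rewrite (le_trans ab')// ler_wpM2l.
have B' : (1 + s) * a' <= (1 + s) * (C * ((1 + s) * b + (s ^+ 2 + s))).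
  by rewrite ler_wpM2l// addr_ge0// ltW.
apply: (le_trans Lx).
apply: (@le_trans _ _ (C * b + s * (K + K))); last by rewrite lerD2l.
apply: (le_trans (lerD B' (lexx _))).
have Cn : 0 <= C * b by rewrite mulr_ge0.
have -> : (1 + s) * (C * ((1 + s) * b + (s ^+ 2 + s))) =
  C * b + (C * b) * (s ^+ 2 + s + s) + C * (s * s ^+ 2 + s ^+ 2 + s ^+ 2 + s) by ring.
have sss : s * s ^+ 2 <= s by rewrite ger_pMr// (le_trans ss).
have B1 : C * b * (s ^+ 2 + s + s) <= C * b * (s + s + s) by rewrite ler_wpM2l// !lerD.
have B2 : C * (s * s ^+ 2 + s ^+ 2 + s ^+ 2 + s) <= C * (s + s + s + s).
  by rewrite ler_wpM2l// !lerD.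
have Cs : 0 <= C * s by rewrite mulr_ge0// ltW.
have Cns : 0 <= C * b * s by rewrite mulr_ge0// ltW.
rewrite /K; lra.
Qed.

Lemma sqnorm_le_lim (C : R) x y : 0 <= C ->
  (forall e, 0 < e -> exists x' y',
     [/\ N1 x' <= C * N2 y', N1 (x - x') < e & N2 (y - y') < e]) ->
  N1 x <= C * N2 y.
Proof.
move=> C0 h; apply: relaxed_le_lim => // [|e /h[x' [y' [xy' xx' yy']]]].
  exact: sqnorm_ge0.
exists (N1 x'), (N2 y'); split=> // s s0.
- rewrite -{1}(subrKC x' x) (le_trans (sqnormD_eps d1 _ _ s0))// lerD2l.
  by rewrite ler_wpM2l ?addr_ge0 ?invr_ge0 ?(ltW s0)// ltW.
- rewrite -{1}(subrKC y y') (le_trans (sqnormD_eps d2 _ _ s0))// lerD2l.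
  by rewrite ler_wpM2l ?addr_ge0 ?invr_ge0 ?(ltW s0)// sqnormBC ltW.
Qed.

(** The closure of the relation in the product of the two spaces. For an isometric
relation with dense domain it is the graph of the continuous extension. *)
Definition rel_closure (G : L1 -> L2 -> Prop) x y := forall e : R, 0 < e ->
  exists x' y', [/\ G x' y', N1 (x - x') < e & N2 (y - y') < e].

Definition linear_rel (G : L1 -> L2 -> Prop) := forall a x y x' y',
  G x y -> G x' y' -> G (a *: x + x') (a *: y + y').

Definition isometric_rel (G : L1 -> L2 -> Prop) := forall x y, G x y -> N1 x = N2 y.

Lemma subset_rel_closure G x y : G x y -> rel_closure G x y.
Proof. by move=> Gxy e e0; exists x, y; rewrite !subrr !sqnorm0. Qed.

Lemma rel_closure_linear G : linear_rel G -> linear_rel (rel_closure G).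
Proof.
move=> lG a x y x' y' Gxy Gxy' e e0.
pose c := 2 * sqmod a + 2.
have c0 : 0 < c by rewrite ltr_wpDl// mulr_ge0// sqmod_ge0.
have [u [v [Guv xu yv]]] := Gxy (e / c) (divr_gt0 e0 c0).
have [u' [v' [Guv' xu' yv']]] := Gxy' (e / c) (divr_gt0 e0 c0).
exists (a *: u + u'), (a *: v + v'); split; first exact: lG.
- rewrite opprD addrACA -scalerBr (le_lt_trans (sqnormD_le _ _ _))//.
  rewrite sqnormZ mulrA (@lt_le_trans _ _ (2 * sqmod a * (e / c) + 2 * (e / c)))//.
    by rewrite ler_ltD ?ltr_pM2l// ler_wpM2l ?mulr_ge0 ?sqmod_ge0// ltW.
  by rewrite -mulrDl -/c mulrCA divff ?mulr1// gt_eqF.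
- rewrite opprD addrACA -scalerBr (le_lt_trans (sqnormD_le _ _ _))//.
  rewrite sqnormZ mulrA (@lt_le_trans _ _ (2 * sqmod a * (e / c) + 2 * (e / c)))//.
    by rewrite ler_ltD ?ltr_pM2l// ler_wpM2l ?mulr_ge0 ?sqmod_ge0// ltW.
  by rewrite -mulrDl -/c mulrCA divff ?mulr1// gt_eqF.
Qed.

End isometric_relation.

Section isometric_rel_theory.
Variables (R : realType) (L1 L2 : lmodType R[i]).
Variables (d1 : {dot L1 for Num.conj}) (d2 : {dot L2 for Num.conj}).
Local Open Scope complex_scope.
Local Notation N1 := (sqnorm d1).
Local Notation N2 := (sqnorm d2).

Lemma rel_closure_isometric G :
  isometric_rel d1 d2 G -> isometric_rel d1 d2 (rel_closure d1 d2 G).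
Proof.
move=> iG x y Gxy; apply/eqP; rewrite eq_le -[leRHS]mul1r -[in X in _ && X](mul1r (N1 x)).
apply/andP; split; apply: sqnorm_le_lim => // e e0;
    have [x' [y' [/iG xy' ? ?]]] := Gxy e e0.
- by exists x', y'; rewrite xy' mul1r.
- by exists y', x'; rewrite xy' mul1r.
Qed.

(** The difference of two elements related to x is related to 0. *)
Lemma isometric_rel_inj G x y y' : linear_rel G -> isometric_rel d1 d2 G ->
  G x y -> G x y' -> y = y'.
Proof.
move=> lG iG Gxy Gxy'; have := iG _ _ (lG (-1) _ _ _ _ Gxy Gxy').
rewrite !scaleN1r addNr sqnorm0 addrC => /esym /sqnorm_eq0 /eqP.
by rewrite subr_eq0 => /eqP.
Qed.

(** The geometric rate makes a sequence chosen from approximations Cauchy without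
any passage to subsequences. *)
Definition dot_complete (L : lmodType R[i]) (d : {dot L for Num.conj}) :=
  forall u : nat -> L, (forall n, sqnorm d (u n.+1 - u n) <= 16^-1 ^+ n) ->
  exists z, forall e, 0 < e -> exists n0, forall n, (n0 <= n)%N ->
    sqnorm d (z - u n) < e.

(** Approximations of x in the domain are Cauchy, hence so are the elements related
to them, and their limit is related to x in the closure. *)
Lemma rel_closure_total G : linear_rel G -> isometric_rel d1 d2 G ->
  dot_complete d2 ->
  (forall x e, 0 < e -> exists x' y', G x' y' /\ N1 (x - x') < e) ->
  forall x, exists y, rel_closure d1 d2 G x y.
Proof.
move=> lG iG cL2 dG x.
have i16 n : 0 < 16^-1 ^+ n / 4 :> R by rewrite divr_gt0// exprn_gt0// invr_gt0.
have /choice[u Pu] : forall n, exists p : L1 * L2,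
    G p.1 p.2 /\ N1 (x - p.1) < 16^-1 ^+ n / 4.
  move=> n.
  by have [x' [y' [? ?]]] := dG x _ (i16 n); exists (x', y').
have [|y yu] := cL2 (fun n => (u n).2).
  move=> n; have [[Gu xu] [Gu' xu']] := (Pu n, Pu n.+1).
  have := iG _ _ (lG (-1) _ _ _ _ Gu Gu').
  rewrite !scaleN1r ![- _ + _]addrC => <-.
  rewrite (le_trans (sqnorm_tri _ _ x _))// sqnormBC.
  have : 16^-1 ^+ n.+1 <= 16^-1 ^+ n :> R.
    by rewrite exprS ger_pMl ?exprn_gt0 ?invr_gt0// invf_le1// ler1n.
  lra.
exists y => e e0; have [n0 yn0] := yu e e0.
have [n1 xn1] : exists n1, forall n, (n1 <= n)%N -> 16^-1 ^+ n / 4 < e.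
  have : (fun n => (16^-1 : R) ^+ n) @ \oo --> (0 : R).
    by apply: cvg_expr; rewrite ger0_norm ?invr_ge0// invf_lt1// ltr1n.
  move=> /cvgrPdist_lt/(_ e e0)[n1 _ h]; exists n1 => n /h.
  rewrite sub0r normrN ger0_norm ?exprn_ge0 ?invr_ge0// => h1.
  by have := i16 n; lra.
exists (u (maxn n0 n1)).1, (u (maxn n0 n1)).2.
have [Gu xu] := Pu (maxn n0 n1); split => //.
  by rewrite (lt_trans xu)// xn1// leq_maxr.
by rewrite yn0// leq_maxl.
Qed.

End isometric_rel_theory.

(** * Bounded linear maps and families with equal Gram matrices *)

Section linear_maps.
Variables (R : realType) (L1 L2 : lmodType R[i]).
Variables (d1 : {dot L1 for Num.conj}) (d2 : {dot L2 for Num.conj}).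
Local Open Scope complex_scope.
Local Notation N1 := (sqnorm d1).
Local Notation N2 := (sqnorm d2).
Implicit Types W : L1 -> L2.

Lemma linear_eq0 W : linear W -> W 0 = 0.
Proof. by move=> lW; have := lW (-1) 0 0; rewrite scaler0 addr0 scaleN1r addNr. Qed.

Lemma linear_add W : linear W -> forall x y, W (x + y) = W x + W y.
Proof. by move=> lW x y; have := lW 1 x y; rewrite !scale1r. Qed.

Lemma linear_scale W : linear W -> forall a x, W (a *: x) = a *: W x.
Proof. by move=> lW a x; have := lW a x 0; rewrite linear_eq0// !addr0. Qed.

Lemma linear_sub W : linear W -> forall x y, W (x - y) = W x - W y.
Proof.
by move=> lW x y; rewrite linear_add// -scaleN1r linear_scale// scaleN1r.
Qed.

Lemma linear_big W (I : Type) (s : seq I) (h : I -> L1) : linear W ->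
  W (\sum_(i <- s) h i) = \sum_(i <- s) W (h i).
Proof.
move=> lW; elim: s => [|i s IH]; first by rewrite !big_nil linear_eq0.
by rewrite !big_cons linear_add// IH.
Qed.

(** Polarization. *)
Lemma sqnorm_isometry_dot W : linear W -> (forall x, N2 (W x) = N1 x) ->
  forall x y, d2 (W x) (W y) = d1 x y.
Proof.
move=> lW iW x y.
have Redot u v : complex.Re (d2 (W u) (W v)) = complex.Re (d1 u v).
  have := iW (u + v); rewrite linear_add// !sqnormD !iW => /addrI.
  move: (complex.Re _) (complex.Re _) => p q; lra.
by apply/eqP; rewrite eq_complex !Im_dot -(linear_scale lW) !Redot !eqxx.
Qed.

Lemma unitary_bounded W : unitary d1 d2 W -> bounded_linear d1 d2 W.
Proof.
by case=> lW iW _; split=> //; exists 1 => x; rewrite mul1r /sqnorm iW.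
Qed.

Lemma unitary_sqnorm W : unitary d1 d2 W -> forall x, N2 (W x) = N1 x.
Proof. by case=> _ iW _ x; rewrite /sqnorm iW. Qed.

Lemma bounded_rel_closure W G : bounded_linear d1 d2 W ->
  (forall x y, G x y -> W x = y) ->
  forall x y, rel_closure d1 d2 G x y -> W x = y.
Proof.
move=> [lW [M bW]] WG x y Gxy; apply/eqP; rewrite -subr_eq0; apply/eqP.
pose c := 2 * `|M| + 2; have c0 : 0 < c by rewrite ltr_wpDl// mulr_ge0.
apply: (@sqnorm_small _ _ d2) => e e0.
have [x' [y' [/WG Wx' xx' yy']]] := Gxy (e / c) (divr_gt0 e0 c0).
rewrite (le_trans (sqnorm_tri d2 _ y' _))// -Wx' -linear_sub// Wx'.
apply: (@le_trans _ _ (2 * `|M| * (e / c) + 2 * (e / c))); last first.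
  by rewrite -mulrDl -/c mulrCA divff ?mulr1// gt_eqF.
apply: lerD; last by rewrite ler_wpM2l// sqnormBC ltW.
rewrite -mulrA ler_wpM2l// (le_trans (bW _))//.
by rewrite (le_trans (ler_wpM2r (sqnorm_ge0 _ _) (ler_norm M)))// ler_wpM2l// ltW.
Qed.

End linear_maps.

Section gram.
Variables (R : realType) (L : lmodType R[i]) (I : Type).
Implicit Types (f : I -> L) (s : seq (R[i] * I)).

Definition lincomb f s : L := \sum_(p <- s) p.1 *: f p.2.

Definition dense_span (d : {dot L for Num.conj}) f :=
  forall z e, 0 < e -> exists s, sqnorm d (z - lincomb f s) < e.

Lemma lincombD f a s s' :
  lincomb f ([seq (a * p.1, p.2) | p <- s] ++ s') = a *: lincomb f s + lincomb f s'.
Proof.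
rewrite /lincomb big_cat big_map scaler_sumr/=; congr (_ + _).
by apply: eq_bigr => p _; rewrite scalerA.
Qed.

End gram.

Section gram_extension.
Variables (R : realType) (L1 L2 : lmodType R[i]).
Variables (d1 : {dot L1 for Num.conj}) (d2 : {dot L2 for Num.conj}).
Variables (I : Type) (f : I -> L1) (g : I -> L2).
Local Notation N1 := (sqnorm d1).
Local Notation N2 := (sqnorm d2).

Definition lincomb_rel x y :=
  exists s : seq (R[i] * I), x = lincomb f s /\ y = lincomb g s.

Lemma lincomb_rel_linear : linear_rel lincomb_rel.
Proof.
move=> a x y x' y' [s [-> ->]] [s' [-> ->]].
by exists ([seq (a * p.1, p.2) | p <- s] ++ s'); rewrite !lincombD.
Qed.

Hypothesis df : dense_span d1 f.

Section bounded_extension.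
Variable W : L1 -> L2.
Hypotheses (bW : bounded_linear d1 d2 W) (Wf : forall i, W (f i) = g i).

Lemma bounded_lincomb s : W (lincomb f s) = lincomb g s.
Proof.
have [lW _] := bW; rewrite /lincomb linear_big//.
by apply: eq_bigr => p _; rewrite linear_scale// Wf.
Qed.

Lemma lincomb_rel_bounded x y : rel_closure d1 d2 lincomb_rel x y -> W x = y.
Proof.
by apply: bounded_rel_closure => // _ _ [s [-> ->]]; exact: bounded_lincomb.
Qed.

(** The graph of a bounded map is contained in the closure of its restriction to
the span of f, so the closure determines it. *)
Lemma bounded_graph_closure x : rel_closure d1 d2 lincomb_rel x (W x).
Proof.
move=> e e0; have [lW [M WM]] := bW.
have M1 : 0 < `|M| + 1 by rewrite ltr_wpDl.
have m0 : 0 < Num.min e (e / (`|M| + 1)) by rewrite lt_min e0 divr_gt0.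
have [s] := df x m0; rewrite lt_min => /andP[xs1 xs2].
exists (lincomb f s), (lincomb g s); split => //; first by exists s.
rewrite -bounded_lincomb -linear_sub// (le_lt_trans (WM _))//.
rewrite (@le_lt_trans _ _ ((`|M| + 1) * N1 (x - lincomb f s)))//.
  rewrite ler_wpM2r ?sqnorm_ge0//.
  by rewrite (le_trans (ler_norm M))// lerDl.
by rewrite mulrC -ltr_pdivlMr.
Qed.

End bounded_extension.

Hypothesis fg : forall i j, d2 (g i) (g j) = d1 (f i) (f j).

Lemma lincomb_rel_isometric : isometric_rel d1 d2 lincomb_rel.
Proof.
move=> x y [s [-> ->]]; rewrite /sqnorm /lincomb; congr complex.Re.
rewrite !linear_sumlz; apply: eq_bigr => p _.
rewrite !linear_sumr; apply: eq_bigr => q _.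
by rewrite !linearZl_LR !linearZr_LR/= fg.
Qed.

Let rel_lin := rel_closure_linear (d1 := d1) (d2 := d2) lincomb_rel_linear.
Let rel_iso := rel_closure_isometric lincomb_rel_isometric.

(** Sending a linear combination of f to the same combination of g is an isometric
relation, because the Gram matrices agree, and the closure of this relation is the
graph of the extension. *)
Lemma gram_extension : dot_complete d2 ->
  exists W, bounded_linear d1 d2 W /\ forall i, W (f i) = g i.
Proof.
move=> cL2.
have /choice[W PW] : forall x, exists y, rel_closure d1 d2 lincomb_rel x y.
  apply: (rel_closure_total lincomb_rel_linear lincomb_rel_isometric cL2).
  move=> x e /(df x)[s xs]; exists (lincomb f s), (lincomb g s); split=> //.
  by exists s.
exists W; split; last first.
  move=> i; apply: (isometric_rel_inj rel_lin rel_iso (PW _)).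
  apply: subset_rel_closure; exists [:: (1, i)].
  by rewrite /lincomb !big_seq1 !scale1r.
split; last by exists 1 => x; rewrite mul1r (rel_iso (PW x)).
move=> a x y; apply: (isometric_rel_inj rel_lin rel_iso (PW _)).
exact: rel_lin.
Qed.

Section isometric_extension.
Variable W : L1 -> L2.
Hypotheses (bW : bounded_linear d1 d2 W) (Wf : forall i, W (f i) = g i).

Lemma gram_sqnorm x : N2 (W x) = N1 x.
Proof. by have /rel_iso := bounded_graph_closure bW Wf x. Qed.

(** The two families play symmetric roles, so the closed relation is also total in
the other direction, which is surjectivity of the extension. *)
Lemma gram_unitary : dense_span d2 g -> dot_complete d1 -> unitary d1 d2 W.
Proof.
move=> dg cL1; have [lW _] := bW.
split=> //; first by apply: sqnorm_isometry_dot => //; exact: gram_sqnorm.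
pose G y x := lincomb_rel x y.
have lG : linear_rel G.
  by move=> a x y x' y' h h'; exact: (lincomb_rel_linear _ h h').
have iG : isometric_rel d2 d1 G.
  by move=> y x /lincomb_rel_isometric.
move=> y; have [|x xy] := rel_closure_total lG iG cL1 _ y.
  move=> z e /(dg z)[s zs]; exists (lincomb g s), (lincomb f s).
  by split=> //; exists s.
exists x; apply: (lincomb_rel_bounded bW Wf) => e /xy[y' [x' [? ? ?]]].
by exists x', y'.
Qed.

End isometric_extension.
End gram_extension.

Lemma bounded_linear_unique (R : realType) (L1 L2 : lmodType R[i])
    (d1 : {dot L1 for Num.conj}) (d2 : {dot L2 for Num.conj}) (I : Type)
    (f : I -> L1) (W W' : L1 -> L2) :
  dense_span d1 f -> bounded_linear d1 d2 W -> bounded_linear d1 d2 W' ->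
  (forall i, W (f i) = W' (f i)) -> forall x, W x = W' x.
Proof.
move=> df bW bW' WW' x; apply: (lincomb_rel_bounded bW WW').
exact: bounded_graph_closure bW' (fun=> erefl) x.
Qed.

(** * Geometric convergence and completeness of Hilbert spaces *)

Section geometric_convergence.
Variables (K : numFieldType) (V : completeNormedModType K) (u : nat -> V) (c : K).
Hypothesis c0 : 0 < c.
Hypothesis small : forall e : K, 0 < e -> exists n, 2^-1 ^+ n < e.
Hypothesis uc : forall n, `|u n.+1 - u n| <= c * 2^-1 ^+ n.

Let h0 n : 0 < 2^-1 ^+ n :> K.
Proof. by rewrite exprn_gt0// invr_gt0. Qed.

(* Partial sums of the geometric series, in closed form. *)
Let tail n k : `|u (n + k)%N - u n| <= c * (2 * 2^-1 ^+ n - 2 * 2^-1 ^+ (n + k)%N).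
Proof.
elim: k => [|k IH]; first by rewrite addn0 !subrr mulr0 normr0.
rewrite addnS -(subrKA (u (n + k)%N)) (le_trans (ler_normD _ _))//.
rewrite (le_trans (lerD (uc _) IH))// -mulrDr ler_wpM2l ?(ltW c0)//.
rewrite exprS mulrA divff ?pnatr_eq0// mul1r addrCA lerD2l.
by rewrite mulr_natl mulr2n opprD addrA subrr add0r.
Qed.

Let tail_lt n m : (n <= m)%N -> `|u m - u n| < c * (3 * 2^-1 ^+ n).
Proof.
move=> nm; rewrite -(subnKC nm) (le_lt_trans (tail _ _))// ltr_pM2l//.
rewrite (@lt_le_trans _ _ (2 * 2^-1 ^+ n))//.
  by rewrite ltrBlDr ltrDl mulr_gt0.
by rewrite ler_wpM2r ?(ltW (h0 _))// ler_nat.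
Qed.

(** The tails of the geometric series bound the distance to the limit. The field is
abstract because both the real numbers and the complex numbers serve as scalars;
the hypothesis small is the archimedean property that this needs. *)
Lemma geometric_cvg : exists l, forall n, `|l - u n| < c * (4 * 2^-1 ^+ n).
Proof.
have /cauchy_cvgP uL : cauchy (u @ \oo).
  apply: cauchy_exP => e e0.
  have c30 : 0 < c * 3 by rewrite mulr_gt0.
  have [n he] := @small (e / (c * 3)) (divr_gt0 e0 c30).
  exists (u n); exists n => // m /= nm.
  rewrite -ball_normE/= distrC (lt_trans (tail_lt nm))//.
  by rewrite mulrA mulrC -ltr_pdivlMr.
exists (lim (u @ \oo)) => n.
have /cvgrPdist_lt/(_ (c * 2^-1 ^+ n) (mulr_gt0 c0 (h0 n)))[m _ hm] := uL.
rewrite -(subrKA (u (maxn n m))) (le_lt_trans (ler_normD _ _))//.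
have -> : c * (4 * 2^-1 ^+ n) = c * 2^-1 ^+ n + c * (3 * 2^-1 ^+ n) by ring.
by apply: ltrD; [apply: hm; exact: leq_maxr|apply: tail_lt; exact: leq_maxl].
Qed.

End geometric_convergence.

Lemma expn_half_small (R : realType) (e : R) : 0 < e -> exists n, 2^-1 ^+ n < e.
Proof.
move=> e0; have : (fun n => (2^-1 : R) ^+ n) @ \oo --> (0 : R).
  by apply: cvg_expr; rewrite ger0_norm ?invr_ge0// invf_lt1// ltr1n.
move=> /cvgrPdist_lt/(_ e e0)[n _ h]; exists n.
by have := h n (leqnn n); rewrite sub0r normrN ger0_norm ?exprn_ge0 ?invr_ge0.
Qed.

Section hilbert_space.
Variables (R : realType) (H : completeNormedModType R[i]).
Variables (dH : {dot H for Num.conj}) (hH : hilbert_dot dH).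
Local Open Scope complex_scope.

Lemma gt0_real_complex (e : R[i]) : 0 < e -> exists2 r : R, 0 < r & e = r%:C.
Proof.
move=> e0; have eE : e = (complex.Re e)%:C by rewrite RRe_real// gtr0_real.
by exists (complex.Re e) => //; rewrite -ltcR -eE.
Qed.

Lemma hilbert_norm_lt x (e : R) : 0 < e -> (`|x| < e%:C) = (sqnorm dH x < e ^+ 2).
Proof.
move=> e0; rewrite -ltcR -dot_sqnormE hH rmorphXn/= ltr_pXn2r// nnegrE//.
by rewrite ler0c ltW.
Qed.

Lemma hilbert_norm_le x (e : R) : 0 <= e -> (`|x| <= e%:C) = (sqnorm dH x <= e ^+ 2).
Proof.
move=> e0; rewrite -lecR -dot_sqnormE hH rmorphXn/= ler_pXn2r// nnegrE//.
by rewrite ler0c.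
Qed.

(** A squared norm at most 16 ^- n is a norm at most 4 ^- n. *)
Lemma hilbert_complete : dot_complete dH.
Proof.
move=> u hu.
have half n : (2^-1 : R[i]) ^+ n = (2^-1 ^+ n)%:C.
  by rewrite rmorphXn/= fmorphV/= rmorph_nat.
have [||n|l ul] := @geometric_cvg R[i] H u 1.
- by [].
- move=> e /gt0_real_complex[r r0 ->]; have [n hn] := expn_half_small r0.
  by exists n; rewrite half ltcR.
- rewrite mul1r half hilbert_norm_le ?exprn_ge0 ?invr_ge0//.
  rewrite (le_trans (hu n))// exprAC lerXn2r ?nnegrE ?invr_ge0 ?exprn_ge0 ?invr_ge0//.
  by rewrite expr2; lra.
exists l => e e0.
have m0 : 0 < Num.min e 1 / 4 by rewrite divr_gt0// lt_min e0 ltr01.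
have [n0 hn0] := expn_half_small m0.
exists n0 => n nn0.
apply: (@lt_le_trans _ _ ((Num.min e 1) ^+ 2)).
  rewrite -hilbert_norm_lt ?lt_min ?e0 ?ltr01//.
  rewrite (lt_le_trans (ul n))// mul1r half -[4]/(4%:R) -(rmorph_nat (real_complex R)).
  rewrite -rmorphM lecR mulrC -ler_pdivlMr// (le_trans _ (ltW hn0))//.
  by rewrite ler_wiXn2l// ?invr_ge0// invf_le1// ler1n.
rewrite expr2 (@le_trans _ _ (Num.min e 1))//.
  by rewrite ger_pMr ?ge_min ?lexx ?orbT// lt_min e0 ltr01.
by rewrite ge_min lexx.
Qed.

End hilbert_space.

(** * Tensor products of unitary operators *)

Section hilbert_tensor_theory.
Variables (R : realType) (H K HK : completeNormedModType R[i]).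
Variables (dH : {dot H for Num.conj}) (dK : {dot K for Num.conj}).
Variables (dHK : {dot HK for Num.conj}).
Hypothesis hHK : hilbert_dot dHK.
Variable t : {bilinear H -> K -> HK}.
Hypothesis ht : hilbert_tensor dH dK dHK t.
Local Open Scope complex_scope.

Lemma tensor_dense_sum z (e : R) : 0 < e -> exists n (x : 'I_n -> H) (y : 'I_n -> K),
  sqnorm dHK (z - \sum_(i < n) t (x i) (y i)) < e.
Proof.
move=> e0; pose r := Num.min e 1.
have r0 : 0 < r by rewrite lt_min e0 ltr01.
have bz0 : ball z r%:C !=set0.
  by exists z; apply: ballxx; rewrite -[0]/(0%:C) ltcR.
have [w [zw [n [x [y wE]]]]] := tensor_dense ht bz0 (ball_open _ _).
exists n, x, y; move: zw; rewrite -wE; rewrite -ball_normE/= (hilbert_norm_lt hHK)//.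
move=> /lt_le_trans; apply; rewrite expr2 (@le_trans _ _ r)//.
  by rewrite ger_pMr// ge_min lexx orbT.
by rewrite ge_min lexx.
Qed.

Definition elementary (p : H * K) : HK := t p.1 p.2.

Lemma tensor_dense_span : dense_span dHK elementary.
Proof.
move=> z e /(tensor_dense_sum z)[n [x [y h]]].
exists [seq (1, (x i, y i)) | i <- enum 'I_n].
rewrite /lincomb big_map big_enum/=.
by under eq_bigr do rewrite scale1r.
Qed.

End hilbert_tensor_theory.

Lemma bounded_linear_comp (R : realType) (L1 L2 L3 : lmodType R[i])
    (d1 : {dot L1 for Num.conj}) (d2 : {dot L2 for Num.conj})
    (d3 : {dot L3 for Num.conj}) (W : L1 -> L2) (W' : L2 -> L3) :
  bounded_linear d1 d2 W -> bounded_linear d2 d3 W' ->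
  bounded_linear d1 d3 (fun x => W' (W x)).
Proof.
move=> [lW [M bW]] [lW' [M' bW']]; split; first by move=> a x y; rewrite lW lW'.
exists (`|M'| * M) => x; rewrite (le_trans (bW' _))// -mulrA.
rewrite (le_trans (ler_wpM2r (sqnorm_ge0 _ _) (ler_norm M')))//.
by rewrite ler_wpM2l.
Qed.

Section tensor_op_theory.
Variables (R : realType) (H K HK : completeNormedModType R[i]).
Variables (dH : {dot H for Num.conj}) (dK : {dot K for Num.conj}).
Variables (dHK : {dot HK for Num.conj}) (hHK : hilbert_dot dHK).
Variables (t : {bilinear H -> K -> HK}) (ht : hilbert_tensor dH dK dHK t).
Variables (H' K' L : lmodType R[i]).
Variables (dH' : {dot H' for Num.conj}) (dK' : {dot K' for Num.conj}).
Variables (dL : {dot L for Num.conj}) (cL : dot_complete dL).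
Variable t' : H' -> K' -> L.
Hypothesis t'_dot : forall x x' y y', dL (t' x y) (t' x' y') = dH' x x' * dK' y y'.
Variables (A : H -> H') (B : K -> K').
Hypotheses (uA : unitary dH dH' A) (uB : unitary dK dK' B).

Let g (p : H * K) := t' (A p.1) (B p.2).

Let gram p q : dL (g p) (g q) = dHK (elementary t p) (elementary t q).
Proof.
by rewrite t'_dot (tensor_dot ht); case: uA uB => _ -> _ [_ -> _].
Qed.

Let tensor_opP : bounded_linear dHK dL (tensor_op dHK dL t t' A B) /\
  forall x y, tensor_op dHK dL t t' A B (t x y) = t' (A x) (B y).
Proof.
have [W [bW Wg]] := gram_extension (tensor_dense_span hHK ht) gram cL.
rewrite /tensor_op; case: xgetP => [_ _ //|/(_ W)]; case; split=> // x y.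
exact: Wg (x, y).
Qed.

Lemma tensor_op_bounded : bounded_linear dHK dL (tensor_op dHK dL t t' A B).
Proof. by case: tensor_opP. Qed.

Lemma tensor_opE x y : tensor_op dHK dL t t' A B (t x y) = t' (A x) (B y).
Proof. by case: tensor_opP. Qed.

(** The images of the elementary tensors have the same Gram matrix as the elementary
tensors themselves, and they span because both factors are onto. *)
Lemma tensor_op_unitary : dense_span dL (fun p : H' * K' => t' p.1 p.2) ->
  unitary dHK dL (tensor_op dHK dL t t' A B).
Proof.
move=> dt'; apply: (gram_unitary (tensor_dense_span hHK ht) gram) => //.
- exact: tensor_op_bounded.
- by move=> p; exact: tensor_opE.
- move=> z e /(dt' z)[s zs].
  have [_ _ sA] := uA; have [_ _ sB] := uB.
  have /choice[A' A'K] := sA; have /choice[B' B'K] := sB.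
  exists [seq (p.1, (A' p.2.1, B' p.2.2)) | p <- s].
  rewrite (_ : lincomb _ _ = lincomb (fun p : H' * K' => t' p.1 p.2) s)//.
  by rewrite /lincomb big_map; apply: eq_bigr => p _; rewrite /g/= A'K B'K.
- exact: hilbert_complete.
Qed.

End tensor_op_theory.

(** * Frames *)

Lemma sqmodD_eps (R : realType) (a b : R[i]) (s : R) : 0 < s ->
  sqmod (a + b) <= (1 + s) * sqmod a + (1 + s^-1) * sqmod b.
Proof.
have sq (x y : R) : 0 < s ->
    (x + y) ^+ 2 <= (1 + s) * x ^+ 2 + (1 + s^-1) * y ^+ 2.
  move=> s0; rewrite -subr_ge0.
  have si : s * s^-1 = 1 by rewrite divff// gt_eqF.
  have -> : (1 + s) * x ^+ 2 + (1 + s^-1) * y ^+ 2 - (x + y) ^+ 2 =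
      s^-1 * (s * x - y) ^+ 2 + (1 - s * s^-1) * (s * x ^+ 2 - x * y *+ 2) by ring.
  by rewrite si subrr mul0r addr0 mulr_ge0 ?sqr_ge0// invr_ge0 ltW.
move=> s0; rewrite /sqmod Defs.ReD Defs.ImD !mulrDr.
by rewrite addrACA lerD// sq.
Qed.

Lemma esum_pZl (R : realType) (T : choiceType) (I : set T) (a : T -> \bar R) (r : R) :
  0 < r -> (forall i, 0 <= a i)%E ->
  (\esum_(i in I) (r%:E * a i) = r%:E * \esum_(i in I) a i)%E.
Proof.
move=> r0 a0; rewrite /esum -ereal_sup_pZl//; congr ereal_sup.
apply/seteqP; split=> [_ [X [fX XI] <-]|_ [_ [X [fX XI] <-] <-]].
  exists (\sum_(x \in X) a x)%E; first by exists X.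
  by rewrite ge0_mule_fsumr.
by exists X => //; rewrite ge0_mule_fsumr.
Qed.

Lemma esumZl (R : realType) (T : choiceType) (I : set T) (a : T -> \bar R) (r : R) :
  0 <= r -> (forall i, 0 <= a i)%E ->
  (\esum_(i in I) (r%:E * a i) = r%:E * \esum_(i in I) a i)%E.
Proof.
rewrite le_eqVlt => /predU1P[<- a0|]; last exact: esum_pZl.
by rewrite esum1 ?mul0e// => i _; rewrite mul0e.
Qed.

Section frame_density.
Variables (R : realType) (L : lmodType R[i]) (d : {dot L for Num.conj}).
Variables (I : choiceType) (e : I -> L).
Local Notation N := (sqnorm d).

Definition frame_sum z : \bar R := \esum_(i in [set: I]) (sqmod (d z (e i)))%:E.

Lemma frame_sumD x y (s : R) : 0 < s -> (frame_sum (x + y) <=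
  (1 + s)%:E * frame_sum x + (1 + s^-1)%:E * frame_sum y)%E.
Proof.
move=> s0; have s1 : 0 < 1 + s by rewrite addr_gt0.
have s2 : 0 < 1 + s^-1 by rewrite addr_gt0 ?invr_gt0.
rewrite /frame_sum -!esum_pZl//; [|by move=> i; rewrite lee_fin sqmod_ge0..].
rewrite -esumD; [|by move=> i _; rewrite -EFinM lee_fin mulr_ge0 ?sqmod_ge0// ltW..].
by apply: le_esum => i _; rewrite -!EFinM -EFinD lee_fin linearDl sqmodD_eps.
Qed.

(** The bounds pass to the limit one finite partial sum at a time from above, where
each partial sum is continuous; the upper bound then makes the whole sum
continuous, which gives the lower bound. *)
Lemma frame_dense (D : set L) (A B : R) : 0 < A -> A <= B ->
  (forall z r, 0 < r -> exists z', D z' /\ N (z - z') < r) ->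
  (forall z, D z -> (A * N z)%:E <= frame_sum z /\ frame_sum z <= (B * N z)%:E)%E ->
  frame d e.
Proof.
move=> A0 AB dD hD; have B0 : 0 < B by exact: lt_le_trans AB.
have up z : (frame_sum z <= (B * N z)%:E)%E.
  apply: ge_ereal_sup => _ [X [fX _] <-].
  rewrite fsbig_finite//= sumEFin lee_fin.
  set s := finmap.enum_fset _; pose q y := \sum_(i <- s) sqmod (d y (e i)).
  pose M := \sum_(i <- s) N (e i).
  have M0 : 0 <= M by apply: sumr_ge0 => i _; exact: sqnorm_ge0.
  have qM y : q y <= M * N y.
    rewrite /q /M mulr_suml; apply: ler_sum => i _.
    by rewrite mulrC sqmod_dot.
  have qD x y (r : R) : 0 < r -> q (x + y) <= (1 + r) * q x + (1 + r^-1) * q y.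
    move=> r0; rewrite /q !mulr_sumr -big_split; apply: ler_sum => i _ /=.
    by rewrite linearDl sqmodD_eps.
  apply: relaxed_le_lim; [exact: ltW|exact: sqnorm_ge0|move=> r r0].
  have M1 : 0 < M + 1 by rewrite ltr_wpDl.
  have m0 : 0 < Num.min r (r / (M + 1)) by rewrite lt_min r0 divr_gt0.
  have [z' [Dz']] := dD z _ m0; rewrite lt_min => /andP[zr zM].
  exists (q z'), (N z'); split.
  - have [_ h] := hD _ Dz'; rewrite -lee_fin (le_trans _ h)//.
    rewrite /q -sumEFin -fsbig_finite//; apply: ereal_sup_ubound.
    by exists X.
  - move=> t t0; rewrite -(subrKC z' z) (le_trans (qD _ _ _ t0))// lerD2l.
    rewrite ler_wpM2l ?addr_ge0 ?invr_ge0 ?(ltW t0)// (le_trans (qM _))//.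
    rewrite (@le_trans _ _ ((M + 1) * N (z - z')))//.
      by rewrite ler_wpM2r ?sqnorm_ge0// lerDl.
    by rewrite mulrC -ler_pdivlMr// ltW.
  - move=> t t0; rewrite -(subrKC z z') (le_trans (sqnormD_eps d _ _ t0))// lerD2l.
    by rewrite ler_wpM2l ?addr_ge0 ?invr_ge0 ?(ltW t0)// sqnormBC ltW.
exists A, B; split=> // z; split; last exact: up.
have Sfin y : frame_sum y = (fine (frame_sum y))%:E.
  rewrite fineK// ge0_fin_numE ?(le_lt_trans (up y)) ?ltry//.
  by apply: esum_ge0 => i _; rewrite lee_fin sqmod_ge0.
rewrite -/(frame_sum z) Sfin lee_fin -ler_pdivlMl//.
have S0 y : 0 <= fine (frame_sum y).
  by rewrite fine_ge0//; apply: esum_ge0 => i _; rewrite lee_fin sqmod_ge0.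
apply: relaxed_le_lim; rewrite ?invr_ge0 ?(ltW A0)// => r r0.
have m0 : 0 < Num.min r (r / B) by rewrite lt_min r0 divr_gt0.
have [z' [Dz']] := dD z _ m0; rewrite lt_min => /andP[zr zB].
exists (N z'), (fine (frame_sum z')); split.
- by have [h _] := hD _ Dz'; move: h; rewrite Sfin lee_fin ler_pdivlMl.
- move=> t t0; rewrite -{1}(subrKC z' z) (le_trans (sqnormD_eps d _ _ t0))// lerD2l.
  by rewrite ler_wpM2l ?addr_ge0 ?invr_ge0 ?(ltW t0)// ltW.
- move=> t t0; have := frame_sumD z (z' - z) t0.
  rewrite subrKC Sfin (Sfin z) (Sfin (z' - z)) -!EFinM -EFinD lee_fin => /le_trans.
  apply; rewrite lerD2l ler_wpM2l ?addr_ge0 ?invr_ge0 ?(ltW t0)//.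
  rewrite -lee_fin -Sfin (le_trans (up _))// lee_fin sqnormBC mulrC.
  by rewrite -ler_pdivlMr// ltW.
Qed.

End frame_density.

(** * The tensor product of two frames *)

Section tensor_frame.
Variables (R : realType) (H K HK : completeNormedModType R[i]).
Variables (dH : {dot H for Num.conj}) (dK : {dot K for Num.conj}).
Variables (dHK : {dot HK for Num.conj}) (hHK : hilbert_dot dHK).
Variables (t : {bilinear H -> K -> HK}) (ht : hilbert_tensor dH dK dHK t).
Local Open Scope complex_scope.

Definition tensor_sum (s : seq (H * K)) : HK := \sum_(p <- s) t p.1 p.2.

Lemma tensor_sum_cons p s : tensor_sum (p :: s) = t p.1 p.2 + tensor_sum s.
Proof. by rewrite /tensor_sum big_cons. Qed.

Definition orthogonal_seq (s : seq K) := pairwise (fun u v => dK u v == 0) s.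

(** One Gram--Schmidt step: the components of y along the vectors already present
are moved into the left factors. A vanishing vector of the sequence has
coefficient 0, division by 0 being 0. *)
Lemma orthogonal_step (s : seq (H * K)) x y :
  orthogonal_seq (unzip2 s) -> exists y' s',
  [/\ unzip2 s' = unzip2 s, all (fun u => dK y' u == 0) (unzip2 s)
    & tensor_sum s' + t x y' = tensor_sum s + t x y].
Proof.
elim: s => [_|p s IH /=]; first by exists y, [::].
rewrite /orthogonal_seq/= => /andP[ps /IH[y' [s' [ss' ys' E]]]].
pose a := dK y' p.2 / dK p.2 p.2.
exists (y' - a *: p.2), ((p.1 + a *: x, p.2) :: s'); split.
- by rewrite /= ss'.
- apply/andP; split.
    rewrite linearBl linearZl_LR/=; have [p0|p0] := eqVneq p.2 0.
      by rewrite p0 (linear0r dK y') (linear0r dK 0) mulr0 subrr.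
    by rewrite divfK ?subrr// dnorm_eq0.
  apply/allP => u us; rewrite linearBl linearZl_LR/=.
  by rewrite (eqP (allP ys' u us)) (eqP (allP ps u us)) mulr0 subrr.
- have zm (A B C D : HK) : A + B + C + (D - B) = A + (C + D).
    by rewrite -(addrA A) -addrA [D - B]addrC addrACA subrr add0r.
  rewrite !tensor_sum_cons/= linearDl linearBr linearZl_LR linearZr_LR/=.
  by rewrite zm E addrA.
Qed.

Lemma orthogonal_tensor_sum s : exists s',
  orthogonal_seq (unzip2 s') /\ tensor_sum s' = tensor_sum s.
Proof.
elim: s => [|[x y] s [s' [os' E]]]; first by exists [::].
have [y' [s'' [ss'' ys'' E']]] := orthogonal_step x y os'.
exists ((x, y') :: s''); rewrite /orthogonal_seq/= ss'' ys''; split=> //.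
by rewrite !tensor_sum_cons/= addrC E' E addrC.
Qed.

Lemma sqnorm_orthogonal_sum (T : eqType) (c : T -> R[i]) (k : T -> K) (s : seq T) :
  orthogonal_seq (map k s) ->
  sqnorm dK (\sum_(p <- s) c p *: k p) = \sum_(p <- s) sqmod (c p) * sqnorm dK (k p).
Proof.
elim: s => [_|p s IH]; first by rewrite !big_nil sqnorm0.
rewrite /orthogonal_seq/= => /andP[ps /IH{}IH]; rewrite !big_cons sqnormD IH sqnormZ.
rewrite (_ : dK _ _ = 0) ?mul0rn ?addr0//.
rewrite linearZl_LR/= linear_sumr big1_seq ?mulr0// => q /andP[_ qs].
by rewrite linearZr_LR/= (eqP (allP ps _ (map_f k qs))) mulr0.
Qed.


Lemma sqnorm_orthogonal_tensor s : orthogonal_seq (unzip2 s) ->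
  sqnorm dHK (tensor_sum s) = \sum_(p <- s) sqnorm dH p.1 * sqnorm dK p.2.
Proof.
elim: s => [_|p s IH]; first by rewrite /tensor_sum !big_nil sqnorm0.
rewrite /orthogonal_seq/= => /andP[ps /IH{}IH].
rewrite tensor_sum_cons big_cons sqnormD IH.
rewrite (_ : dHK _ _ = 0) ?mul0rn ?addr0//.
  rewrite /sqnorm (tensor_dot ht) !dot_sqnormE.
  by rewrite -rmorphM/=.
rewrite /tensor_sum linear_sumr big1_seq// => q /andP[_ qs].
by rewrite /= (tensor_dot ht) (eqP (allP ps _ (map_f snd qs))) mulr0.
Qed.

(** For a sum of elementary tensors with orthogonal right factors, pairing with
x i in the left factors gives a vector of K whose norm splits as a sum; the frame
bounds of y apply to that vector and those of x to each summand. *)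
Lemma tensor_frame (I J : choiceType) (x : I -> H) (y : J -> K) :
  frame dH x -> frame dK y -> frame dHK (fun ij : I * J => t (x ij.1) (y ij.2)).
Proof.
move=> [A1 [B1 [A10 AB1 fx]]] [A2 [B2 [A20 AB2 fy]]].
have B10 : 0 < B1 by exact: lt_le_trans AB1.
have B20 : 0 < B2 by exact: lt_le_trans AB2.
pose D := [set z | exists2 s, orthogonal_seq (unzip2 s) & z = tensor_sum s].
apply: (@frame_dense _ _ _ _ _ D (A2 * A1) (B2 * B1)).
- exact: mulr_gt0.
- by apply: ler_pM => //; exact: ltW.
- move=> z r /(tensor_dense_sum hHK ht z)[n [a [b zab]]].
  have [s [os sE]] := orthogonal_tensor_sum [seq (a i, b i) | i <- enum 'I_n].
  exists (tensor_sum s); split; first by exists s.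
  by rewrite sE /tensor_sum big_map big_enum.
move=> _ [s os ->]; rewrite (sqnorm_orthogonal_tensor os).
pose u i := \sum_(p <- s) dH p.1 (x i) *: p.2.
have Nu i : sqnorm dK (u i) = \sum_(p <- s) sqmod (dH p.1 (x i)) * sqnorm dK p.2.
  exact: sqnorm_orthogonal_sum.
have -> : frame_sum dHK (fun ij : I * J => t (x ij.1) (y ij.2)) (tensor_sum s) =
    (\esum_(i in [set: I]) \esum_(j in [set: J]) (sqmod (dK (u i) (y j)))%:E)%E.
  rewrite esum_esum; last by move=> *; rewrite lee_fin sqmod_ge0.
  rewrite /frame_sum (_ : [set: I * J] = [set: I] `*`` (fun=> [set: J])).
    apply: eq_esum => -[i j] _ /=; congr (sqmod _)%:E.
    rewrite /tensor_sum /u !linear_sumlz; apply: eq_bigr => p _.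
    by rewrite /= (tensor_dot ht) linearZl_LR.
  by apply/seteqP; split.
have sumE (C : R) : 0 <= C -> (\esum_(i in [set: I]) (C * sqnorm dK (u i))%:E =
    \sum_(p <- s) (C * sqnorm dK p.2)%:E *
      \esum_(i in [set: I]) (sqmod (dH p.1 (x i)))%:E)%E.
  move=> C0; rewrite (eq_esum (b := fun i => \sum_(p <- s)
      ((C * sqnorm dK p.2)%:E * (sqmod (dH p.1 (x i)))%:E)%E)); last first.
    move=> i _; rewrite Nu mulr_sumr -sumEFin; apply: eq_bigr => p _.
    by rewrite -EFinM mulrCA mulrC.
  rewrite esum_sum; last first.
    move=> i p _ _; rewrite -EFinM lee_fin !mulr_ge0 ?sqmod_ge0 ?sqnorm_ge0//.
  apply: eq_bigr => p _; rewrite esumZl// ?mulr_ge0 ?sqnorm_ge0// => i.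
  by rewrite lee_fin sqmod_ge0.
split.
- apply: (@le_trans _ _ (\esum_(i in [set: I]) (A2 * sqnorm dK (u i))%:E)%E); last first.
    by apply: le_esum => i _; have [] := fy (u i).
  rewrite sumE ?(ltW A20)// mulr_sumr -sumEFin; apply: lee_sum => p _.
  rewrite (@le_trans _ _ ((A2 * sqnorm dK p.2)%:E * (A1 * sqnorm dH p.1)%:E)%E)//.
    by rewrite -EFinM lee_fin [sqnorm dH _ * _]mulrC mulrACA.
  rewrite lee_wpmul2l ?lee_fin ?mulr_ge0 ?sqnorm_ge0 ?(ltW A20)//.
  by have [] := fx p.1.
- apply: (@le_trans _ _ (\esum_(i in [set: I]) (B2 * sqnorm dK (u i))%:E)%E).
    by apply: le_esum => i _; have [] := fy (u i).
  rewrite sumE ?(ltW B20)// mulr_sumr -sumEFin; apply: lee_sum => p _.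
  rewrite (@le_trans _ _ ((B2 * sqnorm dK p.2)%:E * (B1 * sqnorm dH p.1)%:E)%E)//.
    rewrite lee_wpmul2l ?lee_fin ?mulr_ge0 ?sqnorm_ge0 ?(ltW B20)//.
    by have [] := fx p.1.
  by rewrite -EFinM lee_fin [sqnorm dH _ * _]mulrC mulrACA.
Qed.

End tensor_frame.

(** * Classes of square integrable functions *)

Section L2_class_theory.
Context d (T : measurableType d) (R : realType) (m : {measure set T -> \bar R}).
Local Open Scope complex_scope.
Local Open Scope quotient_scope.
Implicit Types (f g : T -> R[i]) (u v : L2 m).

Lemma sqint_repr u : sqintegrable m (repr u).
Proof. exact: L2fun_sqint. Qed.

Lemma sqint_lin (a : R[i]) f g : sqintegrable m f -> sqintegrable m g ->
  sqintegrable m (fun x => a * f x + g x).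
Proof.
by move=> sf sg; apply/asboolP/(sqintP a); exact/asboolP.
Qed.

Lemma sqint_sub f g : sqintegrable m f -> sqintegrable m g ->
  sqintegrable m (fun x => f x - g x).
Proof.
move=> sf sg; rewrite (_ : (fun x => _) = (fun x => -1 * g x + f x)).
  exact: sqint_lin.
by apply/funext => x; rewrite mulN1r addrC.
Qed.

Lemma L2_classE f (sf : f \in @sqint _ _ _ m) : L2_class m f = \pi_(L2 m) (L2Fun sf).
Proof.
rewrite /L2_class; congr (\pi_(L2 m) _); apply: val_inj.
by rewrite val_insubd sf.
Qed.

Lemma L2_class_repr u : L2_class m (repr u) = u.
Proof.
have su : (repr u : T -> R[i]) \in @sqint _ _ _ m by exact: L2funP.
rewrite (L2_classE su) -[RHS]reprK; congr (\pi_(L2 m) _); exact: val_inj.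
Qed.

Lemma L2_classP u : exists2 f, sqintegrable m f & u = L2_class m f.
Proof. by exists (repr u); [exact: sqint_repr|rewrite L2_class_repr]. Qed.

Lemma L2_class_eqP f g : sqintegrable m f -> sqintegrable m g ->
  L2_class m f = L2_class m g <-> \forall x \ae m, f x = g x.
Proof.
move=> /asboolP sf /asboolP sg; rewrite (L2_classE sf) (L2_classE sg).
exact: L2_eqP.
Qed.

Lemma repr_L2_class f : sqintegrable m f ->
  \forall x \ae m, repr (L2_class m f) x = f x.
Proof.
move=> sf; apply/L2_class_eqP => //; first exact: sqint_repr.
by rewrite L2_class_repr.
Qed.

Lemma L2_class_lin a f g : sqintegrable m f -> sqintegrable m g ->
  L2_class m (fun x => a * f x + g x) = a *: L2_class m f + L2_class m g.
Proof.
move=> sf sg; have sfg := sqint_lin a sf sg.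
move: (sf) (sg) (sfg) => /asboolP sf' /asboolP sg' /asboolP sfg'.
rewrite (L2_classE sf') (L2_classE sg') (L2_classE sfg').
rewrite -[a *: _]/(L2_scale a _) L2_scaleE -raddfD/=.
by apply/L2_eqP/aeW => x; rewrite L2funD.
Qed.

Lemma L2_class_sub f g : sqintegrable m f -> sqintegrable m g ->
  L2_class m (fun x => f x - g x) = L2_class m f - L2_class m g.
Proof.
move=> sf sg; rewrite -[RHS]addrC -scaleN1r -L2_class_lin//.
by congr L2_class; apply/funext => x; rewrite mulN1r addrC.
Qed.

Lemma L2_dot_class f g : sqintegrable m f -> sqintegrable m g ->
  L2_dot m (L2_class m f) (L2_class m g) = cint m (fun x => f x * Num.conj (g x)).
Proof.
move=> /asboolP sf /asboolP sg; rewrite (L2_classE sf) (L2_classE sg).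
exact: L2_dotE.
Qed.

Lemma mul_conj_sqmod (z : R[i]) : z * Num.conj z = (sqmod z)%:C.
Proof. by rewrite -normCK -add_Re2_Im2. Qed.

Lemma sqnorm_class f : sqintegrable m f ->
  (sqnorm (L2_dot m) (L2_class m f))%:E = (\int[m]_x (sqmod (f x))%:E)%E.
Proof.
move=> sf; rewrite -[sqnorm _ _]/(complex.Re (L2_dot m _ _)) L2_dot_class// /cint/=.
under eq_Rintegral do rewrite mul_conj_sqmod/=.
rewrite /Rintegral fineK// ge0_fin_numE; first by case: sf.
by apply: integral_ge0 => x _; rewrite lee_fin sqmod_ge0.
Qed.


(** Multiplication by functions of modulus at most 1: this covers the indicator
functions of the canonical spectral measure and the characters. *)
Definition contractive f := measurable_cfun f /\ forall x, sqmod (f x) <= 1.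

Lemma sqmodM (z w : R[i]) : sqmod (z * w) = sqmod z * sqmod w.
Proof. rewrite /sqmod Defs.ReM Defs.ImM; ring. Qed.

Lemma sqmod_conj (z : R[i]) : sqmod (Num.conj z) = sqmod z.
Proof. by rewrite /sqmod Defs.Re_conj Defs.Im_conj sqrrN. Qed.

Lemma contractive_conj f : contractive f -> contractive (fun x => Num.conj (f x)).
Proof.
move=> [mf f1]; split; first exact: measurable_cfun_conj.
by move=> x; rewrite sqmod_conj.
Qed.

Lemma contractiveM f g : contractive f -> contractive g ->
  contractive (fun x => f x * g x).
Proof.
move=> [mf f1] [mg g1]; split; first exact: measurable_cfunM.
by move=> x; rewrite sqmodM mulr_ile1 ?sqmod_ge0.
Qed.

Lemma contractive_indic (A : set T) : measurable A ->
  contractive (fun x => (\1_A x)%:C).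
Proof.
move=> mA; split; first by split=> //=; exact: measurable_indic.
by move=> x; rewrite /sqmod/= expr0n addr0 indicE; case: (_ \in _); rewrite ?expr0n ?expr1n.
Qed.

Lemma sqint_contractive f g : contractive f -> sqintegrable m g ->
  sqintegrable m (fun x => f x * g x).
Proof.
move=> [mf f1] [mg ig]; split; first exact: measurable_cfunM.
apply: le_lt_trans ig; apply: ge0_le_integral => //.
- by move=> x _; rewrite lee_fin sqmod_ge0.
- by apply/measurable_EFinP/measurable_sqmod; exact: measurable_cfunM.
- by apply/measurable_EFinP/measurable_sqmod.
- by move=> x _; rewrite lee_fin sqmodM ler_piMl ?sqmod_ge0.
Qed.

Definition L2_mul (f : T -> R[i]) u : L2 m := L2_class m (fun x => f x * repr u x).

(** The product does not depend on the representative, so any square integrable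
function may be used to compute it. *)
Lemma L2_mul_class f g : contractive f -> sqintegrable m g ->
  L2_mul f (L2_class m g) = L2_class m (fun x => f x * g x).
Proof.
move=> cf sg; apply/L2_class_eqP; [exact: sqint_contractive (sqint_repr _)|
  exact: sqint_contractive|].
by apply: filterS (repr_L2_class sg) => x ->.
Qed.

Lemma L2_mul_linear f : contractive f -> linear (L2_mul f).
Proof.
move=> cf a u v; have [g sg ->] := L2_classP u; have [h sh ->] := L2_classP v.
rewrite -L2_class_lin// !L2_mul_class//; last exact: sqint_lin.
rewrite -L2_class_lin; [|exact: sqint_contractive..].
by congr L2_class; apply/funext => x; rewrite mulrDr mulrCA.
Qed.

Lemma L2_mulM f g u : contractive f -> contractive g ->
  L2_mul f (L2_mul g u) = L2_mul (fun x => f x * g x) u.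
Proof.
move=> cf cg; have [h sh ->] := L2_classP u.
rewrite !L2_mul_class//; [|exact: contractiveM|exact: sqint_contractive].
by congr L2_class; apply/funext => x; rewrite mulrA.
Qed.

Lemma L2_mul1 u : L2_mul (fun=> 1) u = u.
Proof.
rewrite /L2_mul -[RHS]L2_class_repr; congr L2_class.
by apply/funext => x; rewrite mul1r.
Qed.

Lemma L2_mul_adjoint f u v : contractive f ->
  L2_dot m (L2_mul f u) v = L2_dot m u (L2_mul (fun x => Num.conj (f x)) v).
Proof.
move=> cf; have [g sg ->] := L2_classP u; have [h sh ->] := L2_classP v.
have cf' := contractive_conj cf.
rewrite (L2_mul_class cf sg) (L2_mul_class cf' sh).
rewrite (L2_dot_class (sqint_contractive cf sg) sh).
rewrite (L2_dot_class sg (sqint_contractive cf' sh)).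
by congr cint; apply/funext => x; rewrite rmorphM/= conjCK mulrAC mulrC.
Qed.

Lemma L2_mul_dot f g : contractive f -> sqintegrable m g ->
  L2_dot m (L2_mul f (L2_class m g)) (L2_class m g) =
  cint m (fun x => f x * (sqmod (g x))%:C).
Proof.
move=> cf sg; rewrite (L2_mul_class cf sg) (L2_dot_class (sqint_contractive cf sg) sg).
by congr cint; apply/funext => x; rewrite -mulrA mul_conj_sqmod.
Qed.

End L2_class_theory.


(** * Completeness of L^2 *)

(** With c = 0 the sequence is constant and the strict bound of the geometric case
fails. *)
Lemma geometric_cvg_le (R : realType) (u : nat -> R) (c : R) : 0 <= c ->
  (forall n, `|u n.+1 - u n| <= c * 2^-1 ^+ n) ->
  exists l, forall n, `|l - u n| <= c * (4 * 2^-1 ^+ n).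
Proof.
rewrite le_eqVlt => /predU1P[<- uc|c0 uc]; last first.
  have [l ul] := @geometric_cvg R R u c c0 (@expn_half_small R) uc.
  by exists l => n; exact: ltW.
exists (u 0); elim=> [|n IH]; first by rewrite subrr normr0 mul0r.
rewrite mul0r -(subrKA (u n)) (le_trans (ler_normD _ _))//.
by move: IH (uc n); rewrite !mul0r distrC => IH un; rewrite -[leRHS]addr0 lerD// distrC.
Qed.

Section riesz_fischer.
Context d (T : measurableType d) (R : realType) (m : {measure set T -> \bar R}).
Local Open Scope complex_scope.
Variable f : nat -> T -> R[i].
Hypothesis sf : forall n, sqintegrable m (f n).
Hypothesis df : forall n,
  (\int[m]_x (sqmod (f n.+1 x - f n x))%:E <= (16^-1 ^+ n)%:E)%E.

Let g n x := (4 ^+ n * sqmod (f n.+1 x - f n x))%:E.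
Let s x := (\sum_(n <oo) g n x)%E.

Let g0 n x : (0 <= g n x)%E.
Proof. by rewrite lee_fin mulr_ge0 ?sqmod_ge0 ?exprn_ge0. Qed.

Let mg n : measurable_fun setT (g n).
Proof.
apply/measurable_EFinP; apply: measurable_funM => //.
by have [] := sqint_sub (sf n.+1) (sf n) => /measurable_sqmod.
Qed.

Let ms : measurable_fun setT s.
Proof. by apply: ge0_emeasurable_sum. Qed.

(** The weights 4 ^ n against the rate 16 ^ n make the series of squared
increments integrable while still leaving a geometric rate at each point where the
series converges. *)
Let int_s : (\int[m]_x s x < +oo)%E.
Proof.
rewrite integral_nneseries//.
apply: (@le_lt_trans _ _ (\sum_(n <oo) (4^-1 ^+ n)%:E)%E).
  apply: lee_nneseries => [n _ _|n _]; first exact: integral_ge0.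
  have -> : (\int[m]_x g n x =
      (4 ^+ n)%:E * \int[m]_x (sqmod (f n.+1 x - f n x))%:E)%E.
    rewrite -ge0_integralZl_EFin ?exprn_ge0//.
      by move=> x _; rewrite lee_fin sqmod_ge0.
    apply/measurable_EFinP.
    by have [] := sqint_sub (sf n.+1) (sf n) => /measurable_sqmod.
  apply: (@le_trans _ _ ((4 ^+ n)%:E * (16^-1 ^+ n)%:E)%E).
    by apply: lee_wpmul2l; [rewrite lee_fin exprn_ge0|exact: df].
  rewrite -EFinM lee_fin -exprMn.
  by rewrite (_ : 4 / 16 = 4^-1 :> R)//; lra.
apply: (@le_lt_trans _ _ (2%:E)); last exact: ltry.
apply: lime_le.
  by apply: is_cvg_nneseries => n _ _; rewrite lee_fin exprn_ge0 ?invr_ge0.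
near=> n; rewrite sumEFin lee_fin.
have i4 : `|4^-1 : R| < 1 by rewrite ger0_norm ?invr_ge0// invf_lt1// ltr1n.
have i40 : 0 < 4^-1 :> R by rewrite invr_gt0.
have := @geometric_le_lim R n 1 4^-1 ler01 i40 i4.
rewrite /series/= (eq_bigr (fun i => 4^-1 ^+ i)); last by move=> i _; rewrite mul1r.
move=> /le_trans; apply; rewrite div1r -[leRHS]invrK lef_pV2 ?posrE; lra.
Unshelve. all: end_near. Qed.

(* Where the series diverges the bound is infinite, and any value will do. *)
Let limit_at x : exists l : R[i], forall n,
  ((sqmod (l - f n x))%:E <= (32 * 4^-1 ^+ n)%:E * s x)%E.
Proof.
have [soo|sN] := eqVneq (s x) +oo%E.
  exists 0 => n; rewrite soo gt0_muley ?leey// lte_fin mulr_gt0.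
have s0 : (0 <= s x)%E by apply: nneseries_ge0.
have sE : s x = (fine (s x))%:E.
  by rewrite fineK// ge0_fin_numE// ltey.
have gs n : sqmod (f n.+1 x - f n x) <= fine (s x) * (2^-1 ^+ n) ^+ 2.
  have : (g n x <= s x)%E.
    apply: (@le_trans _ _ (\sum_(0 <= i < n.+1) g i x)%E); last exact: nneseries_lim_ge.
    by rewrite big_nat_recr//= leeDr// sume_ge0.
  rewrite sE lee_fin exprAC -(_ : 4^-1 = 2^-1 ^+ 2 :> R); last by rewrite expr2; lra.
  by rewrite exprVn ler_pdivlMr ?exprn_gt0// mulrC.
pose c := Num.sqrt (fine (s x)).
have c0 : 0 <= c by exact: sqrtr_ge0.
have cE : c ^+ 2 = fine (s x) by rewrite sqr_sqrtr// fine_ge0.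
have small (a b : R) n : a ^+ 2 + b ^+ 2 <= fine (s x) * (2^-1 ^+ n) ^+ 2 ->
    `|a| <= c * 2^-1 ^+ n.
  move=> h; rewrite -ler_sqr ?nnegrE ?mulr_ge0 ?exprn_ge0 ?invr_ge0//.
  by rewrite exprMn cE real_normK ?num_real// (le_trans _ h)// lerDl sqr_ge0.
have [p Pp] : exists l, forall n, `|l - complex.Re (f n x)| <= c * (4 * 2^-1 ^+ n).
  apply: geometric_cvg_le => // n; have := gs n; rewrite /sqmod !raddfB/=.
  exact: small.
have [q Pq] : exists l, forall n, `|l - complex.Im (f n x)| <= c * (4 * 2^-1 ^+ n).
  apply: geometric_cvg_le => // n; have := gs n; rewrite /sqmod !raddfB/= addrC.
  exact: small.
exists (p +i* q) => n; rewrite sE -EFinM lee_fin /sqmod !raddfB/=.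
have sq (a : R) : `|a| <= c * (4 * 2^-1 ^+ n) -> a ^+ 2 <= 16 * 4^-1 ^+ n * fine (s x).
  move=> h; rewrite -real_normK ?num_real// (le_trans (lerXn2r 2 _ _ h))//.
    by rewrite nnegrE !mulr_ge0// exprn_ge0// invr_ge0.
  rewrite !exprMn cE exprAC -(_ : 4^-1 = 2^-1 ^+ 2 :> R); last by rewrite expr2; lra.
  by rewrite mulrC -natrX.
have := sq _ (Pp n); have := sq _ (Pq n).
rewrite -!mulrA; move: (4^-1 ^+ n * _) => y h1 h2.
by apply: (le_trans (lerD h2 h1)); rewrite -mulrDl -natrD.
Qed.

(** Where the weighted series diverges the bound of limit_at is infinite, so that it
holds on the whole space for any value of F there and can be integrated. *)
Lemma riesz_fischer : exists F, sqintegrable m F /\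
  exists C : R, forall n, (\int[m]_x (sqmod (F x - f n x))%:E <= (C * 4^-1 ^+ n)%:E)%E.
Proof.
have /choice[F0 PF0] := limit_at.
pose E := [set x | (s x < +oo)%E].
have mE : measurable E by rewrite -[E]setTI; exact: emeasurable_fun_infty_o.
pose F x := (\1_E x)%:C * F0 x.
have PF x n : ((sqmod (F x - f n x))%:E <= (32 * 4^-1 ^+ n)%:E * s x)%E.
  rewrite /F indicE; have [xE|/negP xE] := boolP (x \in E).
    by rewrite mul1r.
  rewrite (_ : s x = +oo%E) ?gt0_muley ?leey// ?lte_fin ?mulr_gt0 ?exprn_gt0 ?invr_gt0//.
  by apply/eqP; rewrite -leye_eq leNgt; apply/negP => ?; apply: xE; rewrite inE.
have mlim (p : R[i] -> R) : (forall z w, p (z - w) = p z - p w) ->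
    (forall r z, p (r%:C * z) = r * p z) -> (forall z, p z ^+ 2 <= sqmod z) ->
    (forall n, measurable_fun setT (fun x => p (f n x))) ->
    measurable_fun setT (fun x => p (F x)).
  move=> pB pZ p2 mp.
  apply: (@measurable_fun_cvg _ _ _ _ (fun n x => \1_E x * p (f n x))) => //.
    by move=> n; apply: measurable_funM => //; exact: measurable_indic.
  move=> x _; apply/cvgrPdist_lt => e e0.
  have [xE|/negP xE] := boolP (x \in E); last first.
    exists 0%N => // n _; rewrite /F pZ indicE (introF idP xE).
    by rewrite !mul0r subrr normr0.
  have s0 : (0 <= s x)%E by apply: nneseries_ge0.
  have sE : s x = (fine (s x))%:E.
    by rewrite fineK// ge0_fin_numE//; move: xE; rewrite inE.
  have a0 : 0 <= fine (s x) by rewrite fine_ge0.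
  have c0 : 0 < e ^+ 2 / (32 * (fine (s x) + 1)).
    by rewrite divr_gt0 ?exprn_gt0// mulr_gt0// ltr_wpDl.
  have [n0 hn0] := expn_half_small c0.
  exists n0 => // n /= n0n; rewrite indicE xE mul1r -pB.
  rewrite -ltr_sqr ?nnegrE// ?(ltW e0)// real_normK ?num_real//.
  rewrite (le_lt_trans (p2 _))//.
  have := PF x n; rewrite sE -EFinM lee_fin => /le_lt_trans; apply.
  apply: (@le_lt_trans _ _ (32 * 2^-1 ^+ n0 * (fine (s x) + 1))).
    rewrite ler_pM ?mulr_ge0 ?exprn_ge0 ?invr_ge0// ?lerDl// ler_wpM2l//.
    apply: (@le_trans _ _ (2^-1 ^+ n)).
      by rewrite lerXn2r ?nnegrE ?invr_ge0// lef_pV2 ?posrE// ler_nat.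
    by rewrite ler_wiXn2l// ?invr_ge0// invf_le1// ler1n.
  by rewrite mulrAC mulrC -ltr_pdivlMr// mulr_gt0// ltr_wpDl.
have mF : measurable_cfun F.
  split; apply: mlim.
  - by move=> z w; rewrite raddfB.
  - by move=> r z; rewrite Defs.ReM/= mul0r subr0.
  - by move=> z; rewrite lerDl sqr_ge0.
  - by move=> n; have [[]] := sf n.
  - by move=> z w; rewrite raddfB.
  - by move=> r z; rewrite Defs.ImM/= mul0r addr0.
  - by move=> z; rewrite lerDr sqr_ge0.
  - by move=> n; have [[]] := sf n.
have mFf n : measurable_cfun (fun x => F x - f n x).
  have -> : (fun x => F x - f n x) = F + (fun x => -1 * f n x).
    by apply/funext => x; rewrite -[RHS]/(F x + -1 * f n x) mulN1r.
  apply: measurable_cfunD => //; apply: measurable_cfunM.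
    exact: measurable_cfun_cst.
  by have [] := sf n.
have PI n : (\int[m]_x (sqmod (F x - f n x))%:E <=
    (32 * 4^-1 ^+ n)%:E * \int[m]_x s x)%E.
  rewrite -ge0_integralZl_EFin ?mulr_ge0 ?exprn_ge0 ?invr_ge0//; last first.
    by move=> x _; exact: nneseries_ge0.
  apply: ge0_le_integral => //.
  - by move=> x _; rewrite lee_fin sqmod_ge0.
  - by exact/measurable_EFinP/measurable_sqmod.
  - by apply: measurable_funeM.
have s0 : (0 <= \int[m]_x s x)%E by apply: integral_ge0 => x _; exact: nneseries_ge0.
have sfin : (\int[m]_x s x)%E = (fine (\int[m]_x s x))%:E by rewrite fineK// ge0_fin_numE.
exists F; split.
  have -> : F = (fun x => 1 * (F x - f 0 x) + f 0 x).
    by apply/funext => x; rewrite mul1r subrK.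
  apply: sqint_lin => //; split=> //; rewrite (le_lt_trans (PI 0))// sfin.
  by rewrite -EFinM ltry.
exists (32 * fine (\int[m]_x s x)) => n.
by rewrite (le_trans (PI n))// sfin -EFinM lee_fin mulrAC.
Qed.

End riesz_fischer.

Lemma L2_complete d (T : measurableType d) (R : realType)
    (m : {measure set T -> \bar R}) : dot_complete (L2_dot m).
Proof.
move=> u hu; pose f n : T -> R[i] := repr (u n).
have sf n : sqintegrable m (f n) by exact: sqint_repr.
have uE n : u n = L2_class m (f n) by rewrite L2_class_repr.
have [n|F [sF [C FC]]] := riesz_fischer sf.
  rewrite -sqnorm_class; last exact: sqint_sub.
  by rewrite lee_fin L2_class_sub// -!uE hu.
exists (L2_class m F) => e e0.
have C1 : 0 < `|C| + 1 by rewrite ltr_wpDl.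
have [n0 hn0] := expn_half_small (divr_gt0 e0 C1).
exists n0 => n n0n; rewrite uE -L2_class_sub// -lte_fin sqnorm_class; last exact: sqint_sub.
rewrite (le_lt_trans (FC n))// lte_fin.
apply: (@le_lt_trans _ _ ((`|C| + 1) * 2^-1 ^+ n0)); last first.
  by rewrite mulrC -ltr_pdivlMr.
apply: (@le_trans _ _ ((`|C| + 1) * 4^-1 ^+ n)).
  rewrite ler_wpM2r ?exprn_ge0 ?invr_ge0//.
  by rewrite (le_trans (ler_norm C))// lerDl.
rewrite ler_wpM2l ?(ltW C1)//; apply: (@le_trans _ _ (2^-1 ^+ n)).
  by rewrite lerXn2r ?nnegrE ?invr_ge0// lef_pV2 ?posrE// ler_nat.
by rewrite ler_wiXn2l// ?invr_ge0// invf_le1// ler1n.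
Qed.

(** * Measures with a density *)

Section density_measure.
Context d (T : measurableType d) (R : realType) (m : {measure set T -> \bar R}).
Variable h : T -> R.
Hypotheses (mh : measurable_fun setT h) (h0 : forall x, 0 <= h x).
Local Open Scope ereal_scope.

Definition density (A : set T) : \bar R := \int[m]_(x in A) (h x)%:E.

Let density0 : density set0 = 0.
Proof. exact: integral_set0. Qed.

Let density_ge0 A : 0 <= density A.
Proof. by apply: integral_ge0 => x _; rewrite lee_fin. Qed.

Let mEh : measurable_fun setT (EFin \o h).
Proof. exact/measurable_EFinP. Qed.

Let density_sigma_additive : semi_sigma_additive density.
Proof.
move=> A mA tA mUA; rewrite [X in _ --> X]ge0_integral_bigcup//=.
- apply: is_cvg_ereal_nneg_natsum_cond => n _ _; exact: density_ge0.
- exact: measurable_funTS.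
- by move=> x _; rewrite lee_fin.
Qed.

Definition density_measure : {measure set T -> \bar R} :=
  HB.pack_for (measure T R) density
    (isMeasure.Build _ _ _ density density0 density_ge0 density_sigma_additive).

Import HBNNSimple.

(** Both sides are limits of integrals of simple functions, for which the identity
is the definition of the density on level sets. *)
Lemma ge0_integral_density (f : T -> \bar R) : (forall x, 0 <= f x) ->
  measurable_fun setT f ->
  \int[density_measure]_x f x = \int[m]_x (f x * (h x)%:E).
Proof.
move=> f0 mf; pose k := nnsfun_approx measurableT mf.
have kf x : f x = lim ((EFin \o k n) x @[n --> \oo]).
  by apply/esym/cvg_lim => //; exact: cvg_nnsfun_approx.
have kfh x : f x * (h x)%:E = lim ((EFin \o k n) x * (h x)%:E @[n --> \oo]).
  by apply/esym/cvg_lim => //; apply: cvgeZr => //; exact: cvg_nnsfun_approx.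
under eq_integral do rewrite kf.
under [RHS]eq_integral do rewrite kfh.
rewrite monotone_convergence//; last 3 first.
- by move=> n; apply/measurable_EFinP.
- by move=> n x _; rewrite lee_fin.
- by move=> x _ a b ab; rewrite lee_fin; exact/lefP/nd_nnsfun_approx.
rewrite monotone_convergence//; last 3 first.
- by move=> n; apply: emeasurable_funM => //; apply/measurable_EFinP.
- by move=> n x _; rewrite mule_ge0 ?lee_fin.
- move=> x _ a b ab; rewrite lee_wpmul2r ?lee_fin//.
  exact/lefP/nd_nnsfun_approx.
congr (lim (_ @ \oo)); apply/funext => n.
have E x : (k n x)%:E = \sum_(y \in range (k n)) (y * \1_(k n @^-1` [set y]) x)%:E.
  by rewrite fimfunE -fsumEFin.
under eq_integral do rewrite /= E.
have mk y : measurable_fun setT (fun x => (y * \1_(k n @^-1` [set y]) x)%:E).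
  by apply/measurable_EFinP; exact: measurable_funM.
have k0 y x : 0 <= (y * \1_(k n @^-1` [set y]) x)%:E.
  by rewrite EFinM; exact: nnfun_muleindic_ge0.
rewrite ge0_integral_fsum//.
rewrite (eq_integral (fun x => \sum_(y \in range (k n))
    (y * \1_(k n @^-1` [set y]) x)%:E * (h x)%:E)); last first.
  by move=> x _; rewrite /= E ge0_mule_fsuml.
rewrite ge0_integral_fsum//; last 2 first.
- by move=> y; apply: emeasurable_funM.
- by move=> y x _; apply: mule_ge0; [exact: k0|rewrite lee_fin].
apply: eq_fsbigr => r; rewrite inE => -[t _ rt].
under eq_integral do rewrite EFinM.
rewrite integralZl_indic_nnsfun//.
under [RHS]eq_integral do rewrite EFinM -muleA.
rewrite ge0_integralZl//; last 3 first.
- by apply: emeasurable_funM => //; apply/measurable_EFinP.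
- by move=> x _; rewrite mule_ge0 ?lee_fin.
- by rewrite -rt lee_fin.
congr (_ * _); rewrite integral_indic// setIT/=.
under eq_integral do rewrite muleC.
rewrite (eq_integral ((EFin \o h) \_ (k n @^-1` [set r]))); last first.
  by move=> x _; rewrite epatch_indic.
by rewrite -integral_mkcond.
Qed.

Lemma Rintegral_density (f : T -> R) : measurable_fun setT f ->
  (\int[density_measure]_x f x)%R = (\int[m]_x (f x * h x))%R.
Proof.
move=> mf; rewrite /Rintegral; congr fine; rewrite integralE [RHS]integralE.
have mEf : measurable_fun setT (EFin \o f) by exact/measurable_EFinP.
rewrite !ge0_integral_density//; [|exact: measurable_funeneg|exact: measurable_funepos].
congr (_ - _); apply: eq_integral => x _.
- rewrite !funeposE -!EFin_max -EFinM; congr EFin.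
  by rewrite maxr_pMl// mul0r.
- rewrite !funenegE -!EFinN -!EFin_max -EFinM; congr EFin.
  by rewrite maxr_pMl// mul0r mulNr.
Qed.

End density_measure.

Lemma cint_density d (T : measurableType d) (R : realType)
    (m : {measure set T -> \bar R}) (h : T -> R)
    (mh : measurable_fun setT h) (h0 : forall x, 0 <= h x) (f : T -> R[i]) :
  measurable_cfun f ->
  cint (density_measure m mh h0) f = cint m (fun x => f x * (h x)%:C%C).
Proof.
move=> [f1 f2]; rewrite /cint !Rintegral_density//.
congr Complex; apply: eq_Rintegral => x _.
  by rewrite Defs.ReM/= mulr0 subr0.
by rewrite Defs.ImM/= mulr0 add0r.
Qed.

Lemma eq_measure_cint d (T : measurableType d) (R : realType)
    (m m' : {measure set T -> \bar R}) (f : T -> R[i]) :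
  (forall A, measurable A -> m A = m' A) -> cint m f = cint m' f.
Proof.
move=> mm'; rewrite /cint /Rintegral; congr Complex; congr fine;
  by apply: eq_measure_integral => A mA _; rewrite /= mm'.
Qed.

(** * Approximation by indicator functions in L^2 *)

Section L2_closed_span.
Context d (T : measurableType d) (R : realType) (m : {measure set T -> \bar R}).
Local Open Scope complex_scope.

Lemma L2_dominated_cvg (f : T -> R[i]) (fn : nat -> T -> R[i]) (G : T -> R) :
  sqintegrable m f -> (forall n, sqintegrable m (fn n)) ->
  m.-integrable setT (EFin \o G) ->
  (forall x n, sqmod (f x - fn n x) <= G x) ->
  (forall x, sqmod (f x - fn n x) @[n --> \oo] --> 0) ->
  sqnorm (L2_dot m) (L2_class m f - L2_class m (fn n)) @[n --> \oo] --> 0.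
Proof.
move=> sf sfn iG fG f0.
have mq n : measurable_fun setT (fun x => (sqmod (f x - fn n x))%:E).
  by apply/measurable_EFinP; have [/measurable_sqmod] := sqint_sub sf (sfn n).
have [] := @dominated_convergence _ _ R m setT measurableT
  (fun n x => (sqmod (f x - fn n x))%:E) (cst 0%E) (EFin \o G) mq (measurable_cst _) _ iG _.
- by apply: aeW => x _; apply: cvg_EFin; [exact: nearW|exact: f0].
- by apply: aeW => x n _; rewrite gee0_abs lee_fin ?sqmod_ge0.
move=> _ _; rewrite integral_cst// mul0e => cv.
rewrite (_ : (fun n => _) = fine \o (fun n => \int[m]_x (sqmod (f x - fn n x))%:E)%E).
  exact: fine_cvg cv.
apply/funext => n /=; rewrite -sqnorm_class; last exact: sqint_sub.
by rewrite L2_class_sub.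
Qed.

Variable D : set (L2 m).
Hypothesis D_lin : forall a u v, D u -> D v -> D (a *: u + v).
Hypothesis D_closed : forall u,
  (forall e, 0 < e -> exists v, D v /\ sqnorm (L2_dot m) (u - v) < e) -> D u.

Lemma closed_dominated (f : T -> R[i]) (fn : nat -> T -> R[i]) (G : T -> R) :
  sqintegrable m f -> (forall n, sqintegrable m (fn n)) ->
  m.-integrable setT (EFin \o G) ->
  (forall x n, sqmod (f x - fn n x) <= G x) ->
  (forall x, sqmod (f x - fn n x) @[n --> \oo] --> 0) ->
  (forall n, D (L2_class m (fn n))) -> D (L2_class m f).
Proof.
move=> sf sfn iG fG f0 Dfn; apply: D_closed => e e0.
have /cvgrPdist_lt/(_ e e0)[n _ /(_ n (leqnn n))] := L2_dominated_cvg sf sfn iG fG f0.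
rewrite sub0r normrN ger0_norm ?sqnorm_ge0// => rn.
by exists (L2_class m (fn n)).
Qed.

Lemma closed_sub u v : D u -> D v -> D (u - v).
Proof. by move=> Du Dv; rewrite addrC -scaleN1r; exact: D_lin. Qed.

Hypothesis mfin : (m setT < +oo)%E.

Lemma integrable_finite (c : R) : m.-integrable setT (EFin \o cst c).
Proof.
apply/integrableP; split; first exact/measurable_EFinP/measurable_cst.
under eq_integral do rewrite /=.
by rewrite integral_cst// lte_mul_pinfty// lee_fin.
Qed.

Lemma contractive_sqint (f : T -> R[i]) : contractive f -> sqintegrable m f.
Proof.
move=> [mf f1]; split => //; apply: (@le_lt_trans _ _ (\int[m]_x (cst 1%:E x))%E).
  apply: ge0_le_integral => //.
  - by move=> x _; rewrite lee_fin sqmod_ge0.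
  - by apply/measurable_EFinP/measurable_sqmod.
  - by move=> x _; rewrite lee_fin.
by rewrite integral_cst// mul1e.
Qed.


Local Notation ind A := (L2_class m (fun x => (\1_A x)%:C)).
Hypothesis D_ind : forall A, measurable A -> D (ind A).

Import HBNNSimple.

Lemma sqint_real (h : T -> R) : measurable_fun setT h ->
  (\int[m]_x (h x ^+ 2)%:E < +oo)%E -> sqintegrable m (fun x => (h x)%:C).
Proof.
move=> mh ih; split; first by split => //=; exact: measurable_cst.
by under eq_integral do rewrite /sqmod/= expr0n addr0.
Qed.

Lemma sqmod_real (r : R) : sqmod (r%:C) = r ^+ 2.
Proof. by rewrite /sqmod/= expr0n addr0. Qed.

(** The values and the sets are arbitrary so that the induction can drop one of
them. *)
Lemma closed_simple (s : seq R) (A : R -> set T) : (forall y, measurable (A y)) ->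
  let f x := (\sum_(y <- s) y * \1_(A y) x)%:C in
  sqintegrable m f /\ D (L2_class m f).
Proof.
move=> mA /=; have ci y := contractive_sqint (contractive_indic R (mA y)).
elim: s => [|y s [sf Df]].
  have -> : (fun x => (\sum_(y <- [::]) y * \1_(A y) x)%:C) = (fun x => (\1_set0 x)%:C).
    by apply/funext => x; rewrite big_nil indic0.
  split; first by apply: contractive_sqint; exact: contractive_indic.
  exact: D_ind.
have -> : (fun x => (\sum_(z <- y :: s) z * \1_(A z) x)%:C) =
    (fun x => y%:C * (\1_(A y) x)%:C + (\sum_(z <- s) z * \1_(A z) x)%:C).
  by apply/funext => x; rewrite big_cons rmorphD rmorphM.
split; first exact: sqint_lin.
by rewrite L2_class_lin//; apply: D_lin => //; exact: D_ind.
Qed.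

Lemma closed_nnsfun (k : {nnsfun T >-> R}) :
  sqintegrable m (fun x => (k x)%:C) /\ D (L2_class m (fun x => (k x)%:C)).
Proof.
have -> : (fun x => (k x)%:C) = (fun x =>
    (\sum_(y <- finmap.enum_fset (fset_set (range k))) y * \1_(k @^-1` [set y]) x)%:C).
  by apply/funext => x; rewrite {1}fimfunE fsbig_finite.
exact: closed_simple.
Qed.

Lemma closed_nonneg (h : T -> R) : measurable_fun setT h -> (forall x, 0 <= h x) ->
  (\int[m]_x (h x ^+ 2)%:E < +oo)%E -> D (L2_class m (fun x => (h x)%:C)).
Proof.
move=> mh h0 ih.
have mEh : measurable_fun setT (EFin \o h) by exact/measurable_EFinP.
pose k := nnsfun_approx measurableT mEh.
have kh x : k n x @[n --> \oo] --> h x.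
  have := cvg_nnsfun_approx measurableT mEh (fun x _ => _) (x := x) Logic.I.
  by move=> /(_ (fun x => h0 x)) /fine_cvg.
have kle n x : k n x <= h x.
  rewrite -(cvg_lim _ (kh x))//.
  apply: (@nondecreasing_cvgn_le _ (fun n => k n x)); last exact: cvgP (kh x).
  by move=> a b ab; exact/lefP/nd_nnsfun_approx.
apply: (@closed_dominated _ (fun n x => (k n x)%:C) (fun x => h x ^+ 2)).
- exact: sqint_real.
- by move=> n; have [] := closed_nnsfun (k n).
- apply/integrableP; split; first by apply/measurable_EFinP; exact: measurable_funX.
  by under eq_integral do rewrite /= ger0_norm ?sqr_ge0//.
- move=> x n; rewrite -rmorphB sqmod_real lerXn2r ?nnegrE ?subr_ge0//.
  by rewrite lerBlDr lerDl.
- move=> x; rewrite (_ : (fun n => _) = (fun n => (h x - k n x) ^+ 2)).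
    have hk0 : h x - k n x @[n --> \oo] --> 0.
      by rewrite -(subrr (h x)); apply: cvgB => //; exact: cvg_cst.
    under eq_fun do rewrite expr2.
    by rewrite -(mulr0 (0 : R)); exact: cvgM.
  by apply/funext => n; rewrite -rmorphB sqmod_real.
- by move=> n; have [] := closed_nnsfun (k n).
Qed.

(** A closed subspace that contains the indicator functions contains the simple
functions, their monotone limits, and differences and complex combinations of these,
which is every class. *)
Lemma indic_total u : D u.
Proof.
have [f sf ->] := L2_classP u; have [[mre mim] _] := sf.
have sq (h : T -> R) : measurable_fun setT h -> (forall x, h x ^+ 2 <= sqmod (f x)) ->
    sqintegrable m (fun x => (h x)%:C).
  move=> mh hf; apply: sqint_real => //.
  have [mf] := sf; apply: le_lt_trans; apply: ge0_le_integral => //.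
  - by move=> x _; rewrite lee_fin sqr_ge0.
  - by apply/measurable_EFinP; exact: measurable_funX.
  - exact/measurable_EFinP/measurable_sqmod.
  - by move=> x _; rewrite lee_fin.
have Dsq (h : T -> R) : measurable_fun setT h -> (forall x, h x ^+ 2 <= sqmod (f x)) ->
    D (L2_class m (fun x => (h x)%:C)).
  move=> mh hf.
  have hp (k : T -> R) : measurable_fun setT k -> (forall x, k x ^+ 2 <= sqmod (f x)) ->
      let p x := (Num.max (k x) 0)%:C in sqintegrable m p /\ D (L2_class m p).
    move=> mk kf p.
    have mp : measurable_fun setT (fun x => Num.max (k x) 0) by exact: measurable_maxr.
    have pf x : (Num.max (k x) 0) ^+ 2 <= sqmod (f x).
      by case: (leP 0 (k x)) => _ //; rewrite expr0n sqmod_ge0.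
    have sp := sq _ mp pf; split => //; apply: closed_nonneg => //.
      by move=> x; rewrite le_max lexx orbT.
    by have [_] := sp; under eq_integral do rewrite sqmod_real.
  have [sp Dp] := hp h mh hf.
  have [||sn Dn] := hp (fun x => - h x).
  - exact: measurableT_comp.
  - by move=> x; rewrite sqrrN.
  have -> : (fun x => (h x)%:C) =
      (fun x => (Num.max (h x) 0)%:C - (Num.max (- h x) 0)%:C).
    apply/funext => x; rewrite -rmorphB; congr (_%:C).
    by case: (leP 0 (h x)) => hx; case: (leP 0 (- h x)) => hx'; lra.
  by rewrite L2_class_sub//; exact: closed_sub.
have re2 x : complex.Re (f x) ^+ 2 <= sqmod (f x) by rewrite lerDl sqr_ge0.
have im2 x : complex.Im (f x) ^+ 2 <= sqmod (f x) by rewrite lerDr sqr_ge0.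
have -> : f = (fun x => 'i * (complex.Im (f x))%:C + (complex.Re (f x))%:C).
  by apply/funext => x; rewrite addrC; case: (f x) => a b; exact: complexE.
rewrite L2_class_lin; [|exact: sq..].
by apply: D_lin; exact: Dsq.
Qed.

End L2_closed_span.

(** * Products of L^2 spaces *)

Section product_integral.
Context d1 d2 (T1 : measurableType d1) (T2 : measurableType d2) (R : realType).
Variables (m1 : {finite_measure set T1 -> \bar R}).
Variables (m2 : {finite_measure set T2 -> \bar R}).
Local Open Scope complex_scope.

Section real.
Variables (p : T1 -> R) (q : T2 -> R).
Hypothesis ip : m1.-integrable setT (EFin \o p).
Hypothesis iq : m2.-integrable setT (EFin \o q).
Let pq (z : T1 * T2) := (p z.1 * q z.2)%:E.

Let mpq : measurable_fun setT pq.
Proof.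
have /measurable_EFinP mp := measurable_int _ ip.
have /measurable_EFinP mq := measurable_int _ iq.
apply/measurable_EFinP; apply: measurable_funM.
  exact: (measurableT_comp mp measurable_fst).
exact: (measurableT_comp mq measurable_snd).
Qed.

Lemma integrable_mul_prod : (m1 \x m2)%E.-integrable setT pq.
Proof.
have /integrableP[mp fp] := ip; have /integrableP[mq fq] := iq.
have q0 : (0 <= \int[m2]_y `|(EFin \o q) y|)%E by exact: integral_ge0.
apply/(integrable12ltyP m1 m2 mpq).
have E x : (\int[m2]_y `|pq (x, y)| = `|p x|%:E * \int[m2]_y `|(EFin \o q) y|)%E.
  rewrite -ge0_integralZl//; last exact: measurableT_comp.
  by apply: eq_integral => y _; rewrite /pq /= normrM EFinM.
under eq_integral do rewrite E.
rewrite ge0_integralZr//; last first.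
  by apply/measurable_EFinP; apply: measurableT_comp => //; exact/measurable_EFinP.
by rewrite lte_mul_pinfty// ?integral_ge0// ge0_fin_numE// integral_ge0.
Qed.

Lemma Rintegral_mul_prod :
  \int[(m1 \x m2)%E]_z (p z.1 * q z.2) = \int[m1]_x p x * \int[m2]_y q y.
Proof.
rewrite /Rintegral -[LHS]/(fine (\int[(m1 \x m2)%E]_z pq z)%E).
rewrite -(integral12_prod_meas1 integrable_mul_prod).
have fq : (\int[m2]_y (q y)%:E)%E = (\int[m2]_y q y)%:E.
  by rewrite fineK//; exact: integrable_fin_num.
have fp : (\int[m1]_x (p x)%:E)%E = (\int[m1]_x p x)%:E.
  by rewrite fineK//; exact: integrable_fin_num.
have -> : (\int[m1]_x fubini_F m2 pq x =
    \int[m1]_x ((p x)%:E * (\int[m2]_y q y)%:E))%E.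
  apply: eq_integral => x _; rewrite -fq -integralZl//.
by rewrite integralZr// fp -EFinM.
Qed.

End real.

Lemma cint_mul_prod (f : T1 -> R[i]) (g : T2 -> R[i]) :
  cintegrable m1 f -> cintegrable m2 g ->
  cintegrable (m1 \x m2)%E (fun z => f z.1 * g z.2) /\
  cint (m1 \x m2)%E (fun z => f z.1 * g z.2) = cint m1 f * cint m2 g.
Proof.
move=> [f1 f2] [g1 g2].
have i11 := integrable_mul_prod f1 g1; have i12 := integrable_mul_prod f1 g2.
have i21 := integrable_mul_prod f2 g1; have i22 := integrable_mul_prod f2 g2.
split.
  split; [under eq_fun do rewrite Defs.ReM EFinB|under eq_fun do rewrite Defs.ImM EFinD].
    exact: integrableB.
  exact: integrableD.
apply/eqP; rewrite eq_complex Defs.ReM Defs.ImM /=; apply/andP; split; apply/eqP.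
  transitivity (\int[(m1 \x m2)%E]_z (complex.Re (f z.1) * complex.Re (g z.2) -
      complex.Im (f z.1) * complex.Im (g z.2))).
    by apply: eq_Rintegral => z _; rewrite Defs.ReM.
  by rewrite RintegralB// (Rintegral_mul_prod f1 g1) (Rintegral_mul_prod f2 g2).
transitivity (\int[(m1 \x m2)%E]_z (complex.Re (f z.1) * complex.Im (g z.2) +
    complex.Im (f z.1) * complex.Re (g z.2))).
  by apply: eq_Rintegral => z _; rewrite Defs.ImM.
by rewrite RintegralD// (Rintegral_mul_prod f1 g2) (Rintegral_mul_prod f2 g1).
Qed.

End product_integral.

(** T is a copy of T1 * T2 under phi, with coordinates p1 and p2, and m is the image
of the product measure. The dual of a product of two groups is such a copy of the
product of the duals. *)
Section L2_product.
Context d d1 d2 (T : measurableType d) (T1 : measurableType d1)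
  (T2 : measurableType d2) (R : realType).
Variables (m1 : {finite_measure set T1 -> \bar R}).
Variables (m2 : {finite_measure set T2 -> \bar R}) (m : {measure set T -> \bar R}).
Variables (phi : T1 * T2 -> T) (p1 : T -> T1) (p2 : T -> T2).
Hypotheses (mphi : measurable_fun setT phi).
Hypotheses (mp1 : measurable_fun setT p1) (mp2 : measurable_fun setT p2).
Hypotheses (p1K : forall z, p1 (phi z) = z.1) (p2K : forall z, p2 (phi z) = z.2).
Hypothesis mE : forall A, measurable A -> m A = (m1 \x m2)%E (phi @^-1` A).
Local Open Scope complex_scope.

Let integral_phi (f : T -> R) : measurable_fun setT f ->
  (m1 \x m2)%E.-integrable setT (fun z => (f (phi z))%:E) ->
  (\int[m]_x (f x)%:E = \int[(m1 \x m2)%E]_z (f (phi z))%:E)%E.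
Proof.
move=> mf fi.
rewrite (eq_measure_integral (pushforward (m1 \x m2)%E phi)); last first.
  by move=> A mA _; rewrite mE.
rewrite integral_pushforward//.
exact/measurable_EFinP.
Qed.

Let ge0_integral_phi (f : T -> R) : measurable_fun setT f -> (forall x, 0 <= f x) ->
  (\int[m]_x (f x)%:E = \int[(m1 \x m2)%E]_z (f (phi z))%:E)%E.
Proof.
move=> mf f0.
rewrite (eq_measure_integral (pushforward (m1 \x m2)%E phi)); last first.
  by move=> A mA _; rewrite mE.
rewrite ge0_integral_pushforward//; first exact/measurable_EFinP.
by move=> x _; rewrite lee_fin.
Qed.

Lemma measurable_cfun_comp d3 (T3 : measurableType d3) (f : T3 -> R[i])
    d4 (T4 : measurableType d4) (p : T4 -> T3) :
  measurable_fun setT p -> measurable_cfun f -> measurable_cfun (fun x => f (p x)).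
Proof.
by move=> mp [f1 f2]; split; [exact: (measurableT_comp f1 mp)|
  exact: (measurableT_comp f2 mp)].
Qed.

Definition tensor_fun (f : T1 -> R[i]) (g : T2 -> R[i]) (x : T) := f (p1 x) * g (p2 x).

Let measurable_tensor_fun f g : measurable_cfun f -> measurable_cfun g ->
  measurable_cfun (tensor_fun f g).
Proof.
by move=> mf mg; apply: measurable_cfunM; exact: measurable_cfun_comp.
Qed.

Lemma cint_tensor_fun f g : measurable_cfun f -> measurable_cfun g ->
  cintegrable m1 f -> cintegrable m2 g ->
  cint m (tensor_fun f g) = cint m1 f * cint m2 g.
Proof.
move=> mf mg cf cg; have [[i1 i2] <-] := cint_mul_prod cf cg.
have [m1' m2'] := measurable_tensor_fun mf mg.
have E z : tensor_fun f g (phi z) = f z.1 * g z.2 by rewrite /tensor_fun p1K p2K.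
rewrite /cint; congr Complex; rewrite /Rintegral; congr fine.
  rewrite integral_phi//; last by under eq_fun do rewrite E.
  by apply: eq_integral => z _; rewrite E.
rewrite integral_phi//; last by under eq_fun do rewrite E.
by apply: eq_integral => z _; rewrite E.
Qed.

Lemma sqint_tensor_fun f g : sqintegrable m1 f -> sqintegrable m2 g ->
  sqintegrable m (tensor_fun f g).
Proof.
move=> sf sg; have [mf _] := sf; have [mg _] := sg.
have mt := measurable_tensor_fun mf mg; split => //.
rewrite ge0_integral_phi//; [|exact: measurable_sqmod|by move=> x; exact: sqmod_ge0].
have := integrable_mul_prod (integrable_sqmod sf) (integrable_sqmod sg).
move=> /integrableP[mh]; apply: le_lt_trans; apply: ge0_le_integral => //.
- by move=> z _; rewrite lee_fin sqmod_ge0.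
- by apply/measurable_EFinP; exact: (measurableT_comp (measurable_sqmod mt) mphi).
- exact: measurableT_comp.
- move=> z _ /=; rewrite /tensor_fun sqmodM p1K p2K lee_fin.
  by rewrite ler_norm.
Qed.

(** A null set of the first factor has a null cylinder. *)
Lemma ae_fst (P : T1 -> Prop) : (\forall x \ae m1, P x) -> \forall x \ae m, P (p1 x).
Proof.
move=> [N [mN N0 PN]]; exists (p1 @^-1` N); split.
- by rewrite -[X in measurable X]setTI; exact: mp1.
- rewrite mE; last by rewrite -[X in measurable X]setTI; exact: mp1.
  rewrite (_ : phi @^-1` _ = N `*` setT).
    transitivity (m1 N * m2 setT)%E; first exact: product_measure1E.
    by rewrite N0 mul0e.
  by apply/seteqP; split=> z /=; rewrite p1K//; case.
- by move=> x /= Px; exact: PN.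
Qed.

Lemma ae_snd (P : T2 -> Prop) : (\forall x \ae m2, P x) -> \forall x \ae m, P (p2 x).
Proof.
move=> [N [mN N0 PN]]; exists (p2 @^-1` N); split.
- by rewrite -[X in measurable X]setTI; exact: mp2.
- rewrite mE; last by rewrite -[X in measurable X]setTI; exact: mp2.
  rewrite (_ : phi @^-1` _ = setT `*` N).
    transitivity (m1 setT * m2 N)%E; first exact: product_measure1E.
    by rewrite N0 mule0.
  by apply/seteqP; split=> z /=; rewrite p2K//; case.
- by move=> x /= Px; exact: PN.
Qed.

Definition L2_product (u : L2 m1) (v : L2 m2) : L2 m :=
  L2_class m (tensor_fun (repr u) (repr v)).

Lemma L2_product_class f g : sqintegrable m1 f -> sqintegrable m2 g ->
  L2_product (L2_class m1 f) (L2_class m2 g) = L2_class m (tensor_fun f g).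
Proof.
move=> sf sg; apply/L2_class_eqP; [apply: sqint_tensor_fun; exact: sqint_repr|
  exact: sqint_tensor_fun|].
apply: filterS2 (ae_fst (repr_L2_class sf)) (ae_snd (repr_L2_class sg)) => x fx gx.
by rewrite /tensor_fun fx gx.
Qed.

(** Fubini's theorem for a function with separated variables. *)
Lemma L2_product_dot u u' v v' :
  L2_dot m (L2_product u v) (L2_product u' v') = L2_dot m1 u u' * L2_dot m2 v v'.
Proof.
have [f sf ->] := L2_classP u; have [f' sf' ->] := L2_classP u'.
have [g sg ->] := L2_classP v; have [g' sg' ->] := L2_classP v'.
rewrite (L2_product_class sf sg) (L2_product_class sf' sg').
rewrite (L2_dot_class (sqint_tensor_fun sf sg) (sqint_tensor_fun sf' sg')).
rewrite (L2_dot_class sf sf') (L2_dot_class sg sg').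
have mc k (S : measurableType k) (h h' : S -> R[i]) : measurable_cfun h ->
    measurable_cfun h' -> measurable_cfun (fun x => h x * Num.conj (h' x)).
  by move=> ? ?; apply: measurable_cfunM => //; exact: measurable_cfun_conj.
rewrite -cint_tensor_fun; last 4 first.
- by apply: mc; [case: sf|case: sf'].
- by apply: mc; [case: sg|case: sg'].
- exact: cintegrable_mul_conj.
- exact: cintegrable_mul_conj.
congr cint; apply/funext => x; rewrite /tensor_fun rmorphM/=.
exact: mulrACA.
Qed.

Lemma L2_mul_product (a : T1 -> R[i]) (b : T2 -> R[i]) u v :
  contractive a -> contractive b ->
  L2_product (L2_mul a u) (L2_mul b v) = L2_mul (tensor_fun a b) (L2_product u v).
Proof.
move=> ca cb; have [f sf ->] := L2_classP u; have [g sg ->] := L2_classP v.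
have cab : contractive (tensor_fun a b).
  case: ca cb => ma a1 [mb b1]; split; first exact: measurable_tensor_fun.
  by move=> x; rewrite sqmodM mulr_ile1 ?sqmod_ge0.
rewrite (L2_mul_class ca sf) (L2_mul_class cb sg) (L2_product_class sf sg).
rewrite (L2_mul_class cab (sqint_tensor_fun sf sg)).
rewrite (L2_product_class (sqint_contractive ca sf) (sqint_contractive cb sg)).
by congr L2_class; apply/funext => x; exact: mulrACA.
Qed.

End L2_product.

Section span_closure.
Variables (R : realType) (L : lmodType R[i]) (d : {dot L for Num.conj}).
Variables (I : Type) (f : I -> L).

Definition span_closure : set L :=
  [set u | forall e, 0 < e -> exists s, sqnorm d (u - lincomb f s) < e].

Lemma span_closure_gen i : span_closure (f i).
Proof.
by move=> e e0; exists [:: (1, i)]; rewrite /lincomb big_seq1 scale1r subrr sqnorm0.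
Qed.

Lemma span_closure_lin a u v :
  span_closure u -> span_closure v -> span_closure (a *: u + v).
Proof.
have rc w : span_closure w -> rel_closure d d (lincomb_rel f f) w w.
  move=> cw e /cw[s hs]; exists (lincomb f s), (lincomb f s); split=> //.
  by exists s.
move=> /rc cu /rc cv e e0.
have [_ [_ [[s [-> _]] hs _]]] :=
  rel_closure_linear (@lincomb_rel_linear _ _ _ _ f f) a cu cv e0.
by exists s.
Qed.

Lemma span_closure_closed u :
  (forall e, 0 < e -> exists v, span_closure v /\ sqnorm d (u - v) < e) ->
  span_closure u.
Proof.
move=> cu e e0; have e4 : 0 < e / 4 by rewrite divr_gt0.
have [v [cv uv]] := cu _ e4; have [s vs] := cv _ e4.
exists s; rewrite (le_lt_trans (sqnorm_tri _ _ v _))//; lra.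
Qed.

End span_closure.

Section L2_product_dense.
Context d d1 d2 (T : measurableType d) (T1 : measurableType d1)
  (T2 : measurableType d2) (R : realType).
Variables (m1 : {finite_measure set T1 -> \bar R}).
Variables (m2 : {finite_measure set T2 -> \bar R}) (m : {measure set T -> \bar R}).
Variables (phi : T1 * T2 -> T) (p1 : T -> T1) (p2 : T -> T2).
Hypotheses (mphi : measurable_fun setT phi).
Hypotheses (mp1 : measurable_fun setT p1) (mp2 : measurable_fun setT p2).
Hypotheses (p1K : forall z, p1 (phi z) = z.1) (p2K : forall z, p2 (phi z) = z.2).
Hypothesis phiK : forall x, phi (p1 x, p2 x) = x.
Hypothesis mE : forall A, measurable A -> m A = (m1 \x m2)%E (phi @^-1` A).
Local Open Scope complex_scope.

Let prod (p : L2 m1 * L2 m2) : L2 m := L2_product m p1 p2 p.1 p.2.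
Let D := span_closure (L2_dot m) prod.
Let q (x : T) := (p1 x, p2 x).
Let ind (A : set T) : L2 m := L2_class m (fun x => (\1_A x)%:C).

Let mq (B : set (T1 * T2)) : measurable B -> measurable (q @^-1` B).
Proof.
move=> mB; rewrite -[X in measurable X]setTI.
exact: (measurable_fun_pair mp1 mp2) measurableT B mB.
Qed.

Let mfin : (m setT < +oo)%E.
Proof.
rewrite mE// preimage_setT -setXTT.
apply: (@le_lt_trans _ _ (m1 setT * m2 setT)%E).
  by rewrite le_eqVlt; apply/orP; left; apply/eqP; exact: product_measure1E.
by rewrite lte_mul_pinfty// ?fin_num_measure// ltey_eq fin_num_measure.
Qed.

Let sqint_ind (A : set T) : measurable A -> sqintegrable m (fun x => (\1_A x)%:C).
Proof. by move=> mA; apply: contractive_sqint => //; exact: contractive_indic. Qed.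

Let finite_contractive k (S : measurableType k) (l : {finite_measure set S -> \bar R})
  (A : set S) : measurable A -> sqintegrable l (fun x => (\1_A x)%:C).
Proof.
move=> mA; apply: contractive_sqint; last exact: contractive_indic.
by rewrite ltey_eq fin_num_measure.
Qed.

Let indE (B : set (T1 * T2)) x : \1_(q @^-1` B) x = \1_B (q x) :> R.
Proof. by rewrite !indicE; congr (_%:R); apply/idP/idP; rewrite !inE. Qed.

Let rectangle (A : set T1) (B : set T2) : measurable A -> measurable B ->
  D (ind (q @^-1` (A `*` B))).
Proof.
move=> mA mB.
suff -> : ind (q @^-1` (A `*` B)) =
    prod (L2_class m1 (fun x => (\1_A x)%:C), L2_class m2 (fun x => (\1_B x)%:C)).
  exact: span_closure_gen.
rewrite /prod/= (L2_product_class mphi mp1 mp2 p1K p2K mE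
  (finite_contractive m1 mA) (finite_contractive m2 mB)).
congr L2_class; apply/funext => x; rewrite /tensor_fun -rmorphM; congr (_%:C).
by rewrite indE !indicE in_setX -natrM mulnb.
Qed.

Let pi_lambda (B : set (T1 * T2)) : measurable B -> D (ind (q @^-1` B)).
Proof.
pose G := [set A `*` B | A in @measurable _ T1 & B in @measurable _ T2].
pose H : set (set (T1 * T2)) := [set B | measurable B /\ D (ind (q @^-1` B))].
suff GH : <<s setT, G>> `<=` H.
  by rewrite measurable_prod_measurableType => /GH[].
apply: lambda_system_subset.
- move=> _ _ [A mA [A' mA' <-]] [C mC [C' mC' <-]]; rewrite -setXI.
  by exists (A `&` C); [exact: measurableI|exists (A' `&` C') => //; exact: measurableI].
- split.
  + by move=> A _; exact: subsetT.
  + split; first exact: measurableT.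
    by rewrite -setXTT; apply: rectangle; exact: measurableT.
  + move=> A C CA [mA DA] [mC DC]; split; first exact: measurableD.
    have -> : ind (q @^-1` (A `\` C)) = ind (q @^-1` A) - ind (q @^-1` C).
      rewrite /ind -L2_class_sub; [|exact/sqint_ind/mq..].
      congr L2_class; apply/funext => x; rewrite -rmorphB; congr (_%:C).
      rewrite !indE !indicE in_setD; have [xC|xC] /= := boolP (q x \in C).
        by rewrite andbF (mem_set (CA _ (set_mem xC))) subrr.
      by rewrite andbT subr0.
    apply: (closed_sub (D := D) _ DA DC) => a x y; exact: span_closure_lin.
  + move=> F ndF HF; have mF n : measurable (F n) by have [] := HF n.
    have mUF : measurable (\bigcup_n F n) by exact: bigcup_measurable.
    split; first exact: mUF.
    apply: (closed_dominated (D := D) _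
      (fn := fun n x => (\1_(q @^-1` F n) x)%:C) (G := cst 1)).
    * by move=> u; exact: span_closure_closed.
    * exact/sqint_ind/mq.
    * by move=> n; exact/sqint_ind/mq.
    * exact: integrable_finite.
    * move=> x n; rewrite -rmorphB sqmod_real !indE !indicE.
      by case: (_ \in _); case: (_ \in _); rewrite ?subrr ?subr0 ?sub0r ?sqrrN ?expr1n ?expr0n.
    * move=> x; apply/cvgrPdist_lt => e e0.
      have [[n _ Fn]|xF] := pselect ((\bigcup_n F n) (q x)).
        exists n => // k /= nk.
        have Fk : F k (q x) by move: Fn; exact/subsetPset/ndF.
        rewrite -rmorphB sqmod_real !indE !indicE (mem_set Fk) mem_set; last by exists n.
        by rewrite subrr expr0n subrr normr0.
      exists 0%N => // k _; rewrite -rmorphB sqmod_real !indE !indicE.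
      rewrite memNset// memNset; last by move=> Fk; apply: xF; exists k.
      by rewrite subrr expr0n subrr normr0.
    * by move=> n; have [] := HF n.
- by move=> _ [A mA [B' mB' <-]]; split; [exact: measurableX|exact: rectangle].
- by move=> X _; exact: subsetT.
Qed.

(** A pi-lambda argument on rectangles gives the indicator functions of all
measurable sets, and these span. *)
Lemma L2_product_dense : dense_span (L2_dot m) prod.
Proof.
move=> u; apply: (indic_total (D := D)) => //.
- by move=> a x y; exact: span_closure_lin.
- by move=> x; exact: span_closure_closed.
- move=> A mA; have -> : A = q @^-1` (phi @^-1` A).
    by apply/seteqP; split=> x /=; rewrite /q phiK.
  apply: pi_lambda; rewrite -[X in measurable X]setTI; exact: mphi.
Qed.

End L2_product_dense.

(** * The dual of a product of groups *)

Section dual_product.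
Variables (R : realType) (G1 G2 : countZmodType).
Variables (lam : probability (dual R G1) R) (mu : probability (dual R G2) R).

Lemma dual_prod_measureX (A : set (dual R G1)) (B : set (dual R G2)) :
  measurable A -> measurable B ->
  dual_prod_measure lam mu (dual_sum A B) = (lam A * mu B)%E.
Proof.
move=> mA mB; transitivity ((lam \x mu)%E (A `*` B)); last exact: product_measure1E.
congr ((lam \x mu)%E _); apply/seteqP; split=> -[x y];
  by have [xE yE] := dual_pairK (x, y); rewrite /= /dual_sum/= xE yE.
Qed.

Lemma mrestr_dual_prodE (E : set (dual R G1)) (F : set (dual R G2))
    (mE : measurable E) (mF : measurable F) (A : set (dual R (G1 * G2)%type)) :
  measurable A ->
  mrestr (dual_prod_measure lam mu) (measurable_dual_sum mE mF) A =
  (mrestr lam mE \x mrestr mu mF)%E (@dual_pair R G1 G2 @^-1` A).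
Proof.
move=> mA; have mpA : measurable (@dual_pair R G1 G2 @^-1` A).
  by rewrite -[X in measurable X]setTI; exact: measurable_dual_pair.
rewrite (product_measure_unique (m' := mrestr (lam \x mu)%E (measurableX mE mF)))//.
  rewrite /mrestr -[LHS]/((lam \x mu)%E (@dual_pair R G1 G2 @^-1` (A `&` dual_sum E F))).
  congr ((lam \x mu)%E _); apply/seteqP; split=> -[x y];
    by have [xE yE] := dual_pairK (x, y); rewrite /= /dual_sum/= xE yE.
move=> B C mB mC.
transitivity ((lam \x mu)%E ((B `&` E) `*` (C `&` F))); first by rewrite setXI.
by apply: product_measure1E; exact: measurableI.
Qed.

Lemma measurable_dual_mul (G : countZmodType) (xi : dual R G) :
  measurable_fun setT (dual_mul xi).
Proof.
apply: measurable_fun_dual => g.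
apply: (@measurable_cfunM _ _ _ (fun=> xi g) (fun x : dual R G => x g)).
  exact: measurable_cfun_cst.
exact: measurable_dual_eval.
Qed.

Lemma dual_mul_pair (xi : dual R (G1 * G2)%type) x y :
  dual_mul xi (dual_pair (x, y)) =
  dual_pair (dual_mul (dual_fst xi) x, dual_mul (dual_snd xi) y).
Proof.
apply: dualP => -[g h]; rewrite /= /dual_pair_fun/=.
by rewrite mulrACA -dualD; congr (xi (_, _) * _); rewrite ?addr0 ?add0r.
Qed.

(** Translation acts on each factor, so it preserves the product measure on
rectangles, which determine it. *)
Lemma normalized_haar_prod : normalized_haar lam -> normalized_haar mu ->
  normalized_haar (dual_prod_measure lam mu).
Proof.
move=> hlam hmu xi A mA.
pose tau (z : dual R G1 * dual R G2) :=
  (dual_mul (dual_fst xi) z.1, dual_mul (dual_snd xi) z.2).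
have mtau : measurable_fun setT tau.
  apply: measurable_fun_pair.
    exact: (measurableT_comp (measurable_dual_mul _) measurable_fst).
  exact: (measurableT_comp (measurable_dual_mul _) measurable_snd).
have mpA : measurable (@dual_pair R G1 G2 @^-1` A).
  by rewrite -[X in measurable X]setTI; exact: measurable_dual_pair.
transitivity (pushforward (lam \x mu)%E tau (@dual_pair R G1 G2 @^-1` A)).
  congr ((lam \x mu)%E _); apply/seteqP; split=> -[x y];
    by rewrite /= dual_mul_pair.
apply/esym; apply: product_measure_unique => // B C mB mC.
transitivity ((lam \x mu)%E
    (dual_mul (dual_fst xi) @^-1` B `*` dual_mul (dual_snd xi) @^-1` C)) => //.
rewrite product_measure1E.
- by congr (_ * _)%E; [exact: hlam|exact: hmu].
- by rewrite -[X in measurable X]setTI; exact: measurable_dual_mul.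
- by rewrite -[X in measurable X]setTI; exact: measurable_dual_mul.
Qed.

End dual_product.

(** * Multiplication operators and spectral measures *)

Section sqmod_measure.
Context d (T : measurableType d) (R : realType) (m : {measure set T -> \bar R}).
Local Open Scope complex_scope.

Definition sqmod_measure (u : L2 m) : {measure set T -> \bar R} :=
  density_measure m (measurable_sqmod (sqint_repr u).1) (fun x => sqmod_ge0 (repr u x)).

(** Both sides integrate the squared modulus of u over A. *)
Lemma sqmod_measureE (u : L2 m) A : measurable A ->
  sqmod_measure u A = (complex.Re (L2_dot m (L2_mul_indic A u) u))%:E.
Proof.
move=> mA; have sf := sqint_repr u; have [mf fi] := sf.
set f : T -> R[i] := repr u in sf mf fi.
have uE : u = L2_class m f by rewrite L2_class_repr.
rewrite -[L2_mul_indic A u]/(L2_mul (fun x => (\1_A x)%:C) u).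
rewrite {2 3}uE L2_mul_dot//; last exact: contractive_indic.
transitivity (fine (\int[m]_(x in A) (sqmod (f x))%:E))%:E.
  rewrite fineK// ge0_fin_numE; last first.
    by apply: integral_ge0 => x _; rewrite lee_fin sqmod_ge0.
  apply: le_lt_trans fi; apply: ge0_subset_integral => //.
    by apply/measurable_EFinP; exact: measurable_sqmod.
  by move=> x _; rewrite lee_fin sqmod_ge0.
congr (fine _)%:E; rewrite [LHS]integral_mkcond; apply: eq_integral => x _.
rewrite Defs.ReM/= mulr0 subr0 patchE indicE.
by case: (x \in A); rewrite ?mul1r ?mul0r.
Qed.

Lemma cint_sqmod_measure (u : L2 m) (b : T -> R[i]) : contractive b ->
  cint (sqmod_measure u) b = L2_dot m (L2_mul b u) u.
Proof.
move=> cb; have [mb _] := cb; rewrite cint_density//.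
have {2 3}-> : u = L2_class m (repr u) by rewrite L2_class_repr.
by rewrite L2_mul_dot//; exact: sqint_repr.
Qed.

Lemma L2_mul_bounded (b : T -> R[i]) : contractive b ->
  bounded_linear (L2_dot m) (L2_dot m) (L2_mul b).
Proof.
move=> cb; split; first exact: L2_mul_linear.
exists 1 => u; have [f sf ->] := L2_classP u; have [mf _] := sf.
have [mb b1] := cb; have sbf := sqint_contractive cb sf; have [mbf _] := sbf.
rewrite mul1r L2_mul_class// -lee_fin !sqnorm_class//; apply: ge0_le_integral => //.
- by move=> x _; rewrite lee_fin sqmod_ge0.
- by apply/measurable_EFinP; exact: measurable_sqmod.
- by apply/measurable_EFinP; exact: measurable_sqmod.
- by move=> x _; rewrite lee_fin sqmodM ler_piMl ?sqmod_ge0.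
Qed.

Lemma complex_indicM (A B : set T) : (fun x => (\1_A x)%:C * (\1_B x)%:C : R[i]) =
  (fun x => (\1_(A `&` B) x)%:C).
Proof.
apply/funext => x; rewrite -rmorphM; congr (_%:C).
by rewrite !indicE in_setI -natrM mulnb.
Qed.

Lemma L2_mul_indicM (A B : set T) (u : L2 m) : measurable A -> measurable B ->
  L2_mul_indic A (L2_mul_indic B u) = L2_mul_indic (A `&` B) u.
Proof.
move=> mA mB; rewrite -[LHS]/(L2_mul _ (L2_mul _ u)) L2_mulM; [|exact: contractive_indic..].
by rewrite complex_indicM.
Qed.

Lemma L2_mul_indicU (A B : set T) (u : L2 m) : measurable A -> measurable B ->
  A `&` B = set0 ->
  L2_mul_indic (A `|` B) u = L2_mul_indic A u + L2_mul_indic B u.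
Proof.
move=> mA mB AB; have [f sf ->] := L2_classP u.
have cA := contractive_indic R mA; have cB := contractive_indic R mB.
have cAB := contractive_indic R (measurableU A B mA mB).
rewrite -[LHS]/(L2_mul _ _) -[X in _ = X + _]/(L2_mul _ _) -[X in _ = _ + X]/(L2_mul _ _).
rewrite (L2_mul_class cA sf) (L2_mul_class cB sf) (L2_mul_class cAB sf).
rewrite -[X in X + _]scale1r -L2_class_lin; [|exact: sqint_contractive..].
congr L2_class; apply/funext => x; rewrite mul1r -mulrDl -rmorphD; congr (_%:C * _).
rewrite !indicE in_setU; have [xA|] /= := boolP (x \in A); last by rewrite add0r.
rewrite memNset ?addr0// => Bx.
by have : (A `&` B) x := conj (set_mem xA) Bx; rewrite AB.
Qed.

(** Continuity from below, by dominated convergence with the squared modulus of u as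
the dominating function. *)
Lemma L2_mul_indic_cvg (F : (set T)^nat) (u : L2 m) : (forall n, measurable (F n)) ->
  nondecreasing_seq F ->
  sqnorm (L2_dot m) (L2_mul_indic (\bigcup_n F n) u - L2_mul_indic (F n) u)
    @[n --> \oo] --> 0.
Proof.
move=> mF ndF; have [f sf ->] := L2_classP u.
have mUF : measurable (\bigcup_n F n) by exact: bigcup_measurable.
have cF n := contractive_indic R (mF n); have cU := contractive_indic R mUF.
under eq_fun do rewrite -[L2_mul_indic (F _) _]/(L2_mul _ _) (L2_mul_class (cF _) sf).
rewrite -[L2_mul_indic (\bigcup_n F n) _]/(L2_mul _ _) (L2_mul_class cU sf).
apply: (@L2_dominated_cvg _ _ _ _ _ (fun n x => (\1_(F n) x)%:C * f x)
  (fun x => sqmod (f x))).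
- exact: sqint_contractive.
- by move=> n; exact: sqint_contractive.
- exact: integrable_sqmod.
- move=> x n; rewrite -mulrBl sqmodM -rmorphB sqmod_real ler_piMl ?sqmod_ge0//.
- move=> x; apply/cvgrPdist_lt => e e0.
  have [[n _ Fn]|xF] := pselect ((\bigcup_n F n) x).
    exists n => // k /= nk.
    have Fk : F k x by move: Fn; exact/subsetPset/ndF.
    rewrite !indicE (mem_set Fk) mem_set; last by exists n.
    by rewrite subrr /sqmod/= expr0n addr0 subrr normr0.
  exists 0%N => // k _; rewrite !indicE.
  rewrite memNset// memNset; last by move=> Fk; apply: xF; exists k.
  by rewrite subrr /sqmod/= expr0n addr0 subrr normr0.
Qed.

End sqmod_measure.

Section intertwining.
Variables (R : realType) (G : countZmodType).
Variable m : {measure set (dual R G) -> \bar R}.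
Local Open Scope complex_scope.

Definition character (g : G) (x : dual R G) : R[i] := x g.

Lemma contractive_character (g : G) : contractive (character g).
Proof.
split; first exact: measurable_dual_eval.
move=> x; have : (sqmod (character g x))%:C = 1.
  by rewrite -mul_conj_sqmod -normCK dual_norm expr1n.
by move=> [->].
Qed.

(** The values of nu on measurable sets are those of the measure with density the
squared modulus of u. *)
Lemma L2_mul_character_dot (u : L2 m) (nu : {measure set (dual R G) -> \bar R}) g :
  (forall A, measurable A -> nu A =
    (complex.Re (L2_dot m (L2_mul_indic A u) u))%:E) ->
  cint nu (fun xi => xi g) = L2_dot m (L2_mul (character g) u) u.
Proof.
move=> hnu; rewrite -(cint_sqmod_measure u (contractive_character g)).
by apply: eq_measure_cint => A mA; rewrite hnu// sqmod_measureE.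
Qed.

(** Polarization for a form that vanishes on the diagonal: replacing y by 'i *: y
reverses the relative sign of the two cross terms. *)
Lemma dot_sesquilinear_eq0 (H L : lmodType R[i]) (dL : {dot L for Num.conj})
    (f U : H -> L) : linear f -> linear U -> (forall x, dL (f x) (U x) = 0) ->
  forall x y, dL (f x) (U y) = 0.
Proof.
move=> lf lU h x y; pose b u v := dL (f u) (U v).
have bD u v : b u v + b v u = 0.
  have := h (u + v); rewrite (linear_add lf) (linear_add lU).
  by rewrite linearDl !linearDr/= !h add0r addr0.
have := bD x ('i *: y); rewrite /b (linear_scale lf) (linear_scale lU).
rewrite linearZl_LR linearZr_LR/= conjCi -/(b x y) -/(b y x).
have /eqP := bD x y; rewrite addr_eq0 => /eqP ->.
rewrite mulrN mulNr opprK -mulr2n => /eqP.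
by rewrite mulrn_eq0/= mulf_eq0 (negbTE (neq0Ci _))/= => /eqP ->; rewrite oppr0.
Qed.

Variables (H : completeNormedModType R[i]) (dH : {dot H for Num.conj}).
Variable pi : G -> H -> H.

(** The weak spectral integral only determines the diagonal products, which
polarization turns into the intertwining relation. *)
Lemma spectral_intertwining (U : H -> L2 m) (P : set (dual R G) -> H -> H) :
  unitary_representation dH pi -> unitary dH (L2_dot m) U ->
  spectral_integral dH pi P ->
  (forall A x, measurable A -> U (P A x) = L2_mul_indic A (U x)) ->
  forall g x, U (pi g x) = L2_mul (character g) (U x).
Proof.
move=> [upi _] [lU dU sU] hP UP g x; have [lpi _ _] := upi g.
have lM := L2_mul_linear (m := m) (contractive_character g).
pose f y := U (pi g y) - L2_mul (character g) (U y).
have lf : linear f.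
  by move=> a y z; rewrite /f lpi lU lU lM scalerBr opprD addrACA.
have f0 y : L2_dot m (f y) (U y) = 0.
  rewrite linearBl/= dU; have [nu nuP ->] := hP y.
  rewrite (@L2_mul_character_dot (U y) nu g) ?subrr// => A mA.
  by rewrite nuP// -UP// dU.
have [z zE] := sU (f x).
have := dot_sesquilinear_eq0 lf lU f0 x z; rewrite zE => /eqP.
by rewrite dnorm_eq0 subr_eq0 => /eqP.
Qed.

End intertwining.

Section spectral_transport.
Variables (R : realType) (G : countZmodType).
Variable m : {measure set (dual R G) -> \bar R}.
Variables (H : completeNormedModType R[i]) (dH : {dot H for Num.conj}).
Hypothesis hH : hilbert_dot dH.
Variables (rho : G -> H -> H) (W : H -> L2 m).
Hypothesis uW : unitary dH (L2_dot m) W.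
Hypothesis rhoW : forall g x, W (rho g x) = L2_mul (character g) (W x).
Local Open Scope complex_scope.

Let W_inj x y : W x = W y -> x = y.
Proof.
have [lW _ _] := uW; move=> /eqP; rewrite -subr_eq0 -linear_sub// => /eqP W0.
apply/eqP; rewrite -subr_eq0; apply/eqP/(@sqnorm_eq0 _ _ dH).
by rewrite -(unitary_sqnorm uW) W0 sqnorm0.
Qed.

(** The canonical spectral measure, carried back by W. Its diagonal measure at x has
the squared modulus of W x as density, so integrating a character against it gives
the multiplication operator, which W turns into rho. *)
Lemma spectral_transport : exists P : set (dual R G) -> H -> H,
  [/\ spectral_measure dH P, spectral_integral dH rho P &
      forall A x, measurable A -> W (P A x) = L2_mul_indic A (W x)].
Proof.
have [lW dW sW] := uW; have /choice[V VK] := sW.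
pose P A x := V (L2_mul_indic A (W x)).
have WP A x : W (P A x) = L2_mul_indic A (W x) by rewrite /P VK.
have lM A : measurable A -> linear (L2_mul_indic (m := m) A).
  move=> mA; exact: (L2_mul_linear (contractive_indic R mA)).
exists P; split=> //.
- split.
  + by move=> A mA a x y; apply: W_inj; rewrite WP !lW !WP; exact: lM.
  + by move=> A x mA; apply: W_inj; rewrite !WP L2_mul_indicM// setIid.
  + move=> A x y mA; rewrite -!dW !WP.
    apply: (etrans (L2_mul_adjoint (W x) (W y) (contractive_indic R mA))).
    congr (L2_dot m _ _); congr L2_mul; apply/funext => z.
    by apply/eqP; rewrite eq_complex Defs.Re_conj Defs.Im_conj /= oppr0 !eqxx.
  + move=> x; apply: W_inj; rewrite WP -[RHS]L2_mul1.
    by congr L2_class; apply/funext => z; rewrite indicT.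
  + by move=> A B x mA mB; apply: W_inj; rewrite !WP L2_mul_indicM.
  + move=> F mF tF x.
    pose B n := \bigcup_(i in `I_n) F i.
    have BS n : B n.+1 = B n `|` F n by rewrite /B IIS bigcup_setU bigcup_set1.
    have mB n : measurable (B n) by apply: bigcup_measurable => i _.
    have ndB : nondecreasing_seq B.
      by apply/nondecreasing_seqP => n; apply/subsetPset; rewrite BS; exact: subsetUl.
    have WS n : W (\sum_(i < n) P (F i) x) = L2_mul_indic (B n) (W x).
      elim: n => [|n IH].
        rewrite big_ord0 (linear_eq0 lW) /B II0 bigcup_set0.
        (* The empty set is the disjoint union of two copies of itself. *)
        have := L2_mul_indicU (W x) measurable0 measurable0 (setI0 _).
        by rewrite setU0 -[LHS]addr0 => /addrI.
      rewrite big_ord_recr/= (linear_add lW) IH WP -L2_mul_indicU// ?BS//.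
      apply/seteqP; split => // z [[i /= ni Fi] Fn].
      have /trivIsetP/(_ i n Logic.I Logic.I) := tF.
      by rewrite neq_ltn ni => /(_ isT) /seteqP[/(_ z (conj Fi Fn))].
    have <- : \bigcup_n B n = \bigcup_n F n.
      apply/seteqP; split=> [z [n _ [i _ Fi]]|z [n _ Fn]]; first by exists i.
      by exists n.+1 => //; exists n => /=.
    apply/cvgrPdist_lt => e /gt0_real_complex[r r0 ->].
    have /cvgrPdist_lt/(_ _ (exprn_gt0 2 r0))[n0 _ hn0] :=
      L2_mul_indic_cvg (W x) mB ndB.
    exists n0 => // n n0n; rewrite (hilbert_norm_lt hH)// -(unitary_sqnorm uW).
    rewrite linear_sub// WP WS.
    by have := hn0 n n0n; rewrite /= sub0r normrN ger0_norm ?sqnorm_ge0.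
- move=> x; exists (sqmod_measure (W x)).
    by move=> A mA; rewrite sqmod_measureE// -dW WP.
  move=> g; rewrite -dW rhoW; apply/esym; apply: cint_sqmod_measure.
  exact: contractive_character.
Qed.

End spectral_transport.

(** * The tensor product of two representations *)

Section tensor_representation_theory.
Variables (R : realType) (G1 G2 : zmodType) (H K HK : completeNormedModType R[i]).
Variables (dH : {dot H for Num.conj}) (dK : {dot K for Num.conj}).
Variables (dHK : {dot HK for Num.conj}) (hHK : hilbert_dot dHK).
Variables (t : {bilinear H -> K -> HK}) (ht : hilbert_tensor dH dK dHK t).
Variables (pi : G1 -> H -> H) (sigma : G2 -> K -> K).
Hypotheses (upi : unitary_representation dH pi).
Hypotheses (usigma : unitary_representation dK sigma).
Let rho := tensor_representation dHK t pi sigma.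

Lemma tensor_representationE gh x y : rho gh (t x y) = t (pi gh.1 x) (sigma gh.2 y).
Proof.
by apply: (tensor_opE hHK ht (hilbert_complete hHK) (tensor_dot ht));
  [exact: upi.1|exact: usigma.1].
Qed.

(** Two bounded maps that agree on elementary tensors are equal, which gives the
homomorphism property. *)
Lemma tensor_representation_unitary : unitary_representation dHK rho.
Proof.
have urho gh : unitary dHK dHK (rho gh).
  apply: (tensor_op_unitary hHK ht (hilbert_complete hHK) (tensor_dot ht)).
  - exact: upi.1.
  - exact: usigma.1.
  - exact (tensor_dense_span hHK ht).
split=> // gh gh'.
apply: (bounded_linear_unique (tensor_dense_span hHK ht)).
- exact/unitary_bounded/urho.
- by apply: bounded_linear_comp; exact/unitary_bounded/urho.
- by move=> p; rewrite /elementary !tensor_representationE upi.2 usigma.2.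
Qed.

(** The orbit of an elementary tensor is the tensor product of the two orbits. *)
Lemma tensor_frame_representation v w :
  frame_representation dH pi v -> frame_representation dK sigma w ->
  frame_representation dHK rho (t v w).
Proof.
move=> [_ fv] [_ fw]; split; first exact: tensor_representation_unitary.
have := tensor_frame hHK ht fv fw; congr frame; apply/funext => gh.
by rewrite tensor_representationE.
Qed.

End tensor_representation_theory.

Section L2_tensor_theory.
Variables (R : realType) (G1 G2 : countZmodType).
Variables (lam : probability (dual R G1) R) (mu : probability (dual R G2) R).
Variables (E : set (dual R G1)) (F : set (dual R G2)).
Variables (mE : measurable E) (mF : measurable F).
Let m1 := mrestr lam mE.
Let m2 := mrestr mu mF.
Let m := mrestr (dual_prod_measure lam mu) (measurable_dual_sum mE mF).

Let fst_pair (z : dual R G1 * dual R G2) : dual_fst (dual_pair z) = z.1.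
Proof. by have := congr1 fst (dual_pairK z). Qed.

Let snd_pair (z : dual R G1 * dual R G2) : dual_snd (dual_pair z) = z.2.
Proof. by have := congr1 snd (dual_pairK z). Qed.

Lemma L2_tensor_dot (u u' : L2 m1) (v v' : L2 m2) :
  L2_dot m (L2_tensor u v) (L2_tensor u' v') = L2_dot m1 u u' * L2_dot m2 v v'.
Proof.
exact: (L2_product_dot (@measurable_dual_pair R G1 G2) (@measurable_dual_fst R G1 G2)
  (@measurable_dual_snd R G1 G2) fst_pair snd_pair (mrestr_dual_prodE lam mu mE mF)).
Qed.

Lemma L2_tensor_dense :
  dense_span (L2_dot m) (fun p : L2 m1 * L2 m2 => L2_tensor p.1 p.2).
Proof.
exact: (L2_product_dense (@measurable_dual_pair R G1 G2) (@measurable_dual_fst R G1 G2)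
  (@measurable_dual_snd R G1 G2) fst_pair snd_pair (@dual_fst_sndK R G1 G2)
  (mrestr_dual_prodE lam mu mE mF)).
Qed.

(** A character of the product is the product of its restrictions to the factors. *)
Lemma L2_tensor_character (gh : G1 * G2) (u : L2 m1) (v : L2 m2) :
  L2_tensor (L2_mul (character gh.1) u) (L2_mul (character gh.2) v) =
  L2_mul (character gh) (L2_tensor u v).
Proof.
have E0 := L2_mul_product (@measurable_dual_pair R G1 G2) (@measurable_dual_fst R G1 G2)
  (@measurable_dual_snd R G1 G2) fst_pair snd_pair (mrestr_dual_prodE lam mu mE mF) u v
  (contractive_character R gh.1) (contractive_character R gh.2).
apply: (etrans E0); congr L2_mul; apply/funext => x.
rewrite /tensor_fun /character /= -dualD; congr (x _).
by case: gh {E0} => g h; congr (_, _); rewrite ?addr0 ?add0r.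
Qed.

End L2_tensor_theory.

(** * Decomposition operators of tensor products *)

Unset Implicit Arguments. Set Strict Implicit.

Theorem theorem5p2 (R : realType) (G1 G2 : countZmodType)
  (H K HK : completeNormedModType R[i])
  (dH : {dot H for Num.conj}) (dK : {dot K for Num.conj})
  (dHK : {dot HK for Num.conj})
  (hH : hilbert_dot dH) (hK : hilbert_dot dK) (hHK : hilbert_dot dHK)
  (sH : separable H) (sK : separable K)
  (t : {bilinear H -> K -> HK}) (ht : hilbert_tensor dH dK dHK t)
  (pi : G1 -> H -> H) (sigma : G2 -> K -> K) (v : H) (w : K)
  (hpi : frame_representation dH pi v)
  (hsigma : frame_representation dK sigma w)
  (lam : probability (dual R G1) R) (mu : probability (dual R G2) R)
  (hlam : normalized_haar lam) (hmu : normalized_haar mu)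
  (E : set (dual R G1)) (F : set (dual R G2))
  (mE : measurable E) (mF : measurable F)
  (U : H -> L2 (mrestr lam mE)) (V : K -> L2 (mrestr mu mF))
  (hU : decomposition_operator dH pi U)
  (hV : decomposition_operator dK sigma V) :
  decomposition_operator dHK (tensor_representation dHK t pi sigma)
    (tensor_op dHK
      (L2_dot (mrestr (dual_prod_measure lam mu) (measurable_dual_sum mE mF)))
      t L2_tensor U V).
Proof.
have [upi _] := hpi; have [usigma _] := hsigma.
have uU := decomposition_unitary hU; have uV := decomposition_unitary hV.
set m := mrestr _ (measurable_dual_sum mE mF); set W := tensor_op _ _ _ _ _ _.
have WE : forall x y, W (t x y) = L2_tensor (U x) (V y).
  exact: (tensor_opE hHK ht (@L2_complete _ _ _ _)
    (@L2_tensor_dot _ _ _ lam mu E F mE mF) uU uV).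
have uW : unitary dHK (L2_dot m) W.
  apply: (tensor_op_unitary hHK ht (@L2_complete _ _ _ _)
    (@L2_tensor_dot _ _ _ lam mu E F mE mF) uU uV).
  exact: L2_tensor_dense.
have urho := tensor_representation_unitary hHK ht upi usigma.
have rhoW gh z : W (tensor_representation dHK t pi sigma gh z) =
    L2_mul (character gh) (W z).
  have [P [_ sP UP]] := decomposition_spectral hU.
  have [Q [_ sQ VQ]] := decomposition_spectral hV.
  move: z; apply: (bounded_linear_unique (tensor_dense_span hHK ht)
    (d2 := L2_dot m)).
  - by apply: bounded_linear_comp; [exact/unitary_bounded/urho.1|exact: unitary_bounded].
  - apply: bounded_linear_comp; first exact: unitary_bounded uW.
    by apply: L2_mul_bounded; exact: contractive_character.
  - move=> p; rewrite /elementary (tensor_representationE hHK ht upi usigma) !WE.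
    rewrite (spectral_intertwining upi uU sP UP) (spectral_intertwining usigma uV sQ VQ).
    exact: L2_tensor_character.
split.
- exists (t v w).
  exact: (tensor_frame_representation hHK ht upi usigma hpi hsigma).
- exact: normalized_haar_prod.
- rewrite dual_prod_measureX//.
  by apply: mule_gt0; [exact: decomposition_gt0 hU|exact: decomposition_gt0 hV].
- exact: uW.
- exact: spectral_transport uW rhoW.
Qed.
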